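(* Let $A\in\mathbb{R}^{n\times d}$, $b\in\mathbb{R}^n$, $p\in[1,2)$, $1\le k\le d$, $\varepsilon,\delta\in(0,1)$. There exists a distribution over random matrices $S\in\mathbb{R}^{m\times n}$ with $m=O\big(k(\log(d/k)+\log(k/(\varepsilon\delta)))/\varepsilon^2\big)$ such that with probability at least $1-\delta$, $$\forall x\in\Psi_k:\ (1-\varepsilon)\|Ax-b\|_p\le\|S(Ax-b)\|_{\mathrm{med}}\le(1+\varepsilon)\|Ax-b\|_p,$$ where for $y\in\mathbb{R}^m$, $\|y\|_{\mathrm{med}}:=\operatorname{median}\{|y_i|: i\in[m]\}$.
   Context: $\Psi_k=\{x\in\mathbb{R}^d:\|x\|_0\le k\}$; $\|y\|_p=(\sum_i|y_i|^p)^{1/p}$.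
   Formalization: The bound on m is read as m ≤ C·max(1, k(log(d/k)+log(k/(εδ)))/ε²) with C absolute; the maximum with 1 matters only for d = k = 1 with ε, δ near 1, where the stated bound tends to 0 and would force m = 0, for which the median is undefined. *)

(* Defs.v *)
From mathcomp Require Import all_boot all_order all_algebra.
From mathcomp Require Import all_classical all_reals all_analysis.

Set Implicit Arguments.
Unset Strict Implicit.
Unset Printing Implicit Defensive.

Import Order.TTheory GRing.Theory Num.Theory.
Import numFieldNormedType.Exports.

Local Open Scope classical_set_scope.
Local Open Scope ring_scope.

Definition l0norm (R : realType) (d : nat) (x : 'cV[R]_d) : nat :=
  #|[set i : 'I_d | x i 0 != 0]%SET|.

Definition sparse (R : realType) (d k : nat) : set 'cV[R]_d :=
  [set x | (l0norm x <= k)%N].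

Definition lpnorm (R : realType) (n : nat) (p : R) (y : 'cV[R]_n) : R :=
  (\sum_(i < n) `|y i 0| `^ p) `^ p^-1.

(* Two middle entries of the sorted sequence are averaged; they are the same
   entry when the size is odd. The empty sequence gets the junk value 0. *)
Definition median (R : realType) (s : seq R) : R :=
  let t := sort <=%R s in
  (t`_(size s).-1./2 + t`_(size s)./2) / 2.

Definition mednorm (R : realType) (m : nat) (y : 'cV[R]_m) : R :=
  median [seq `|y i 0| | i <- enum 'I_m].

Definition random_matrix (R : realType) (disp : measure_display)
    (Omega : measurableType disp) (m n : nat) (S : Omega -> 'M[R]_(m, n)) :=
  forall i j, measurable_fun setT (fun w => S w i j).

Definition med_embedding (R : realType) (m n d k : nat) (p eps : R)
    (A : 'M[R]_(n, d)) (b : 'cV[R]_n) (S : 'M[R]_(m, n)) : Prop :=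
  forall x : 'cV[R]_d, sparse k x ->
    (1 - eps) * lpnorm p (A *m x - b) <= mednorm (S *m (A *m x - b)) /\
    mednorm (S *m (A *m x - b)) <= (1 + eps) * lpnorm p (A *m x - b).

(* The cutoff at 1 is the usual reading of a bound O(f) on a positive integer:
   f itself tends to 0 when d = k = 1 and eps, delta tend to 1. *)
Definition row_bound (R : realType) (d k : nat) (eps delta : R) : R :=
  Num.max 1
    (k%:R * (ln (d%:R / k%:R) + ln (k%:R / (eps * delta))) / eps ^+ 2).

(* Main.v *)
(* A row of S is a vector (X_1, ..., X_n) of independent copies of a nearly
   p-stable variable X, so that <row, y> is distributed nearly like ||y||_p X.
   Everything takes place on finite probability spaces.  For a = p/2 the series
   1 - (1 - z)^a has nonnegative coefficients, so its powers taken at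
   z = cos (h l) are characteristic functions of mixtures of simple random
   walks of step h; they tend to exp (- l^p).  A mixture of walks is unimodal,
   hence its distribution function is almost concave on the positive axis, and
   growing from 1/2 to 3/4 on a bounded interval it leaves a gap of order eps
   between its values at (1 - eps) and (1 + eps) times the median, uniformly in
   p.  This transfers to <row, y> through characteristic functions: indicators
   are approximated by Bernstein polynomials in a cosine.
   The columns of A selected by the support of x, together with b, span a space
   of dimension at most k + 1.  Coordinates in an almost Auerbach basis give a
   net of this space of size (k/eps)^O(k); Chernoff's bound and a union bound
   over the nets of all supports produce a matrix that works at every net point
   and has few rows that are large on a basis vector, which extends the estimate
   from the net to all x. *)
Require Import Defs.
From mathcomp Require Import all_boot all_order all_algebra.
From mathcomp Require Import all_classical all_reals all_analysis.
From mathcomp Require Import ring lra zify complex perm.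

Import Order.TTheory GRing.Theory Num.Theory.
Import numFieldNormedType.Exports.

Local Open Scope classical_set_scope.
Local Open Scope ring_scope.

Set Implicit Arguments.
Unset Strict Implicit.
Unset Printing Implicit Defensive.

(** * Finite laws and a Chernoff bound *)

(** The constant [K] must be the same for all [p], and no lower bound on the density of a p-stable
    law near its median is at hand. The gap is extracted from two crude facts instead: less than
    half of the mass lies within 1/40 of 0, and at least 3/4 of it within 128. Decreasing increments
    on a grid of mesh proportional to [eps] then force a jump of order [eps] on either side of the
    median. The order of the choices is the other constraint. The accuracy wanted for [<row, y>] is
    independent of [n], but a product of [n] characteristic functions multiplies the error by [n].
    Hence the comparison constants are uniform over all laws, and the law of a single entry is
    chosen last. At [p = 1] the tail of a row at level [B] is only of order [1 / B], so some rows
    must be allowed to be large on the basis. The cutoff [B] enters only through the logarithm of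
    the net size, which makes a polynomial cutoff affordable. The distribution may depend on [A] and
    [b], so an existence argument is enough. *)

Record law (R : realType) (T : finType) := Law {
  weight :> T -> R;
  weight_ge0 : forall t, 0 <= weight t;
  weight_sum : \sum_t weight t = 1 }.

Section FiniteLaw.
Variables (R : realType) (T : finType) (q : law R T).
Implicit Types (f g : T -> R) (A B : pred T).

Definition expect f := \sum_t q t * f t.
Definition prob A := expect (fun t => (A t)%:R).

Lemma expect_le f g : (forall t, f t <= g t) -> expect f <= expect g.
Proof. by move=> fg; apply: ler_sum => t _; rewrite ler_wpM2l// weight_ge0. Qed.

Lemma eq_expect f g : f =1 g -> expect f = expect g.
Proof. by move=> fg; apply: eq_bigr => t _; rewrite fg. Qed.

Lemma expect_cst (c : R) : expect (fun=> c) = c.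
Proof. by rewrite /expect -mulr_suml weight_sum mul1r. Qed.

Lemma expectD f g : expect (fun t => f t + g t) = expect f + expect g.
Proof. by rewrite /expect -big_split; apply: eq_bigr => t _; rewrite mulrDr. Qed.

Lemma expectZ (c : R) f : expect (fun t => c * f t) = c * expect f.
Proof. by rewrite /expect mulr_sumr; apply: eq_bigr => t _; rewrite mulrCA. Qed.

Lemma expectB f g : expect (fun t => f t - g t) = expect f - expect g.
Proof.
by rewrite -(mulN1r (expect g)) -expectZ -expectD; apply: eq_expect => t; rewrite mulN1r.
Qed.

Lemma expect_sum (I : Type) (r : seq I) (P : pred I) (F : I -> T -> R) :
  expect (fun t => \sum_(i <- r | P i) F i t) = \sum_(i <- r | P i) expect (F i).
Proof.
by rewrite /expect exchange_big; apply: eq_bigr => t _; rewrite mulr_sumr.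
Qed.

Lemma prob_le_expect A f :
  (forall t, 0 <= f t) -> (forall t, A t -> 1 <= f t) -> prob A <= expect f.
Proof.
move=> f0 f1; apply: expect_le => t; have := f1 t; case: (A t) => [/(_ isT)//|_].
exact: f0.
Qed.

Lemma prob_sub A B : (forall t, A t -> B t) -> prob A <= prob B.
Proof. by move=> AB; apply: expect_le => t; rewrite ler_nat; case: (A t) (AB t) => // ->. Qed.

Lemma prob_ge0 A : 0 <= prob A.
Proof. by apply: sumr_ge0 => t _; rewrite mulr_ge0 ?weight_ge0. Qed.

Lemma prob_le1 A : prob A <= 1.
Proof. by rewrite -[leRHS](expect_cst 1); apply: expect_le => t; rewrite lern1 leq_b1. Qed.

Lemma probC A : prob (fun t => ~~ A t) = 1 - prob A.
Proof.
by rewrite -[X in X - _](expect_cst 1) -expectB; apply: eq_expect => t;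
  case: (A t); rewrite /= ?subrr ?subr0.
Qed.

Lemma prob_exists (I : finType) (F : I -> pred T) :
  prob (fun t => [exists i, F i t]) <= \sum_i prob (F i).
Proof.
rewrite -expect_sum; apply: expect_le => t.
case: existsP => [[i Fi]|_] /=; last by apply: sumr_ge0.
by rewrite (bigD1 i)//= Fi lerDl sumr_ge0.
Qed.

Lemma prob_lt1_witness A : prob A < 1 -> exists t, ~~ A t.
Proof.
move=> PA; apply/existsP; rewrite -negb_forall; apply: contraTN PA => /forallP AT.
by rewrite -leNgt -[leLHS](expect_cst 1); apply: expect_le => t; rewrite AT.
Qed.

End FiniteLaw.

Section ProductLaw.
Variables (R : realType) (T : finType) (q : law R T) (n : nat).

Let iid_weight (t : {ffun 'I_n -> T}) := \prod_i q (t i).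

Let iid_weight_ge0 t : 0 <= iid_weight t.
Proof. by apply: prodr_ge0 => i _; apply: weight_ge0. Qed.

Let iid_weight_sum : \sum_t iid_weight t = 1.
Proof.
rewrite /iid_weight -(bigA_distr_bigA (fun (_ : 'I_n) t => q t)) /=.
by rewrite big1// => i _; exact: weight_sum.
Qed.

Definition iid : law R {ffun 'I_n -> T} := Law iid_weight_ge0 iid_weight_sum.

Lemma expect_iid_prod (F : 'I_n -> T -> R) :
  expect iid (fun t => \prod_i F i (t i)) = \prod_i expect q (F i).
Proof.
by rewrite /expect bigA_distr_bigA; apply: eq_bigr => t _; rewrite -big_split.
Qed.

End ProductLaw.
Arguments iid {R T} q n.

(** [expR x <= 1 / (1 - x)], and [(1 + x + 2 x^2) (1 - x) = 1 + x^2 (1 - 2 x)] is at least 1 on this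
    range. *)
Lemma expR_le_quadratic (R : realType) (x : R) :
  0 <= x -> x <= 2^-1 -> expR x <= 1 + x + 2 * x ^+ 2.
Proof.
move=> x0 x1; have xlt : 0 < 1 - x by lra.
rewrite -[x in expR x]opprK expRN; apply: (@le_trans _ _ (1 - x)^-1).
  by rewrite lef_pV2 ?posrE ?expR_gt0// expR_ge1Dx.
rewrite -[leLHS]mul1r ler_pdivrMr//; nra.
Qed.

Section Chernoff.
Variables (R : realType) (T : finType) (q : law R T) (m : nat).

Lemma iid_count_tail (g : pred T) (rho tau : R) :
  prob q g <= rho -> 0 <= tau -> tau <= 2 ->
  prob (iid q m) (fun t => m%:R * (rho + tau) <= #|[set i | g (t i)]%SET|%:R)
    <= expR (- (m%:R * (tau ^+ 2 / 8))).
Proof.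
(* [tau / 4] minimises the exponent [2 th^2 - tau th]; [tau <= 2] keeps it within the range of the
   quadratic bound on [expR]. *)
move=> grho tau0 tau2; pose th := tau / 4.
have th0 : 0 <= th by rewrite /th; lra.
have th1 : th <= 2^-1 by rewrite /th; lra.
pose F (t : {ffun 'I_m -> T}) :=
  expR (- (m%:R * (rho + tau) * th)) * \prod_i expR (th * (g (t i))%:R).
apply: (@le_trans _ _ (expect (iid q m) F)).
  apply: prob_le_expect => t; first by
    rewrite mulr_ge0 ?expR_ge0// prodr_ge0// => *; rewrite expR_ge0.
  move=> h; rewrite /F -expR_sum -expRD -[leLHS]expR0 ler_expR -mulr_sumr.
  have -> : \sum_i (g (t i))%:R = #|[set i | g (t i)]%SET|%:R :> R.
    rewrite -sum1dep_card natr_sum [RHS]big_mkcond; apply: eq_bigr => i _.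
    by case: (g (t i)).
  by rewrite [th * _]mulrC -mulNr -mulrDl mulr_ge0// addrC subr_ge0.
rewrite /F expectZ (expect_iid_prod q (fun _ t => expR (th * (g t)%:R))).
rewrite prodr_const card_ord.
have Eg : expect q (fun t => expR (th * (g t)%:R)) <= expR (rho * th + 2 * th ^+ 2).
  have -> : expect q (fun t => expR (th * (g t)%:R)) = 1 + prob q g * (expR th - 1).
    rewrite -[X in X + _](expect_cst q 1) [X in _ + X]mulrC -expectZ -expectD.
    apply: eq_expect => t.
    by case: (g t); rewrite ?mulr1 ?mulr0 ?expR0 ?addr0// addrC subrK.
  apply: le_trans (expR_ge1Dx _); rewrite lerD2l.
  have := expR_le_quadratic th0 th1; have := prob_ge0 q g; have := prob_le1 q g => P1 P0 E.
  nra.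
apply: (@le_trans _ _ (expR (- (m%:R * (rho + tau) * th)) * expR (rho * th + 2 * th ^+ 2) ^+ m)).
  rewrite ler_wpM2l ?expR_ge0// lerXn2r ?nnegrE ?expR_ge0//.
  by apply: sumr_ge0 => t _; rewrite mulr_ge0 ?expR_ge0 ?weight_ge0.
rewrite -expRM_natl -expRD ler_expR /th.
suff -> : - (m%:R * (rho + tau) * (tau / 4)) + m%:R * (rho * (tau / 4) + 2 * (tau / 4) ^+ 2) =
   - (m%:R * (tau ^+ 2 / 8)) by [].
by field.
Qed.

Lemma iid_sample_exists (I : finType) (g : I -> pred T) (rho : I -> R) (tau : R) :
  (forall i, prob q (g i) <= rho i) -> 0 <= tau -> tau <= 2 ->
  #|I|%:R * expR (- (m%:R * (tau ^+ 2 / 8))) < 1 ->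
  exists t : {ffun 'I_m -> T}, forall i,
    #|[set j | g i (t j)]%SET|%:R < m%:R * (rho i + tau).
Proof.
move=> grho tau0 tau2 I1.
pose bad i (t : {ffun 'I_m -> T}) :=
  m%:R * (rho i + tau) <= #|[set j | g i (t j)]%SET|%:R.
have [|t] := @prob_lt1_witness _ _ (iid q m) (fun t => [exists i, bad i t]).
  apply: le_lt_trans I1; apply: le_trans (prob_exists _ _) _.
  apply: (@le_trans _ _ (\sum_(i : I) expR (- (m%:R * (tau ^+ 2 / 8))))).
    by apply: ler_sum => i _; exact: iid_count_tail.
  by rewrite sumr_const -[leLHS]mulr_natl lexx.
by rewrite negb_exists => /forallP h; exists t => i; rewrite ltNge h.
Qed.

End Chernoff.

(** * Characteristic functions *)

Section TrigBounds.
Variable R : realType.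
Implicit Types x y : R.

Lemma MVT0 (f df : R -> R) (b : R) : 0 <= b ->
  (forall x, is_derive x 1 f (df x)) ->
  exists2 c, 0 <= c <= b & f b - f 0 = df c * b.
Proof.
move=> b0 fdf; have [|c cb E] := MVT_segment b0 (fun x _ => fdf x).
  apply: continuous_subspaceT => x; apply/differentiable_continuous/derivable1_diffP.
  by case: (fdf x).
by exists c; [move: cb; rewrite in_itv | rewrite E subr0].
Qed.

Lemma sin_le x : 0 <= x -> sin x <= x.
Proof.
move=> x0; have [c _] := MVT0 x0 (@is_derive_sin R).
by rewrite sin0 subr0 => ->; rewrite ler_piMl// cos_le1.
Qed.

Lemma norm_sin_le x : `|sin x| <= `|x|.
Proof.
wlog x0 : x / 0 <= x => [h|].
  by have [/h//|/ltW x0] := leP 0 x; rewrite -normrN -sinN -[leRHS]normrN h// oppr_ge0.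
have [x1|x1] := leP x 1; last first.
  by rewrite (le_trans (sin_max x))// (le_trans (ltW x1))// ler_norm.
have := @pi_ge2 R => pi2.
rewrite !ger0_norm ?sin_le// sin_ge0_pi// x0/=; lra.
Qed.

Lemma cos_half x : cos x = 1 - 2 * sin (x / 2) ^+ 2.
Proof.
rewrite {1}(_ : x = (x / 2) *+ 2); last by rewrite -mulr_natr divfK.
by rewrite cos_mulr2n cos2sin2 -mulr_natr; ring.
Qed.

Lemma cos_ge x : 1 - x ^+ 2 / 2 <= cos x.
Proof.
rewrite cos_half; have := norm_sin_le (x / 2).
rewrite -(ler_pXn2r (_ : 0 < 2)%N)// !real_normK ?num_real//; nra.
Qed.

Lemma sin_ge x : 0 <= x -> x * (1 - x ^+ 2 / 2) <= sin x.
Proof.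
move=> x0; have [c /andP[c0 cx]] := MVT0 x0 (@is_derive_sin R).
rewrite sin0 subr0 => ->; rewrite mulrC ler_wpM2r//.
by apply: le_trans (cos_ge _); rewrite lerD2l lerN2 ler_wpM2r// lerXn2r.
Qed.

Lemma cosM x y : cos x * cos y = (cos (x + y) + cos (x - y)) / 2.
Proof. by rewrite cosD cosB; field. Qed.

Lemma dirichlet_kernel (N : nat) x :
  2 * sin (x / 2) * \sum_(j < N) cos (j.+1%:R * x) = sin (N%:R * x + x / 2) - sin (x / 2).
Proof.
elim: N => [|N IH]; first by rewrite big_ord0 mulr0 mul0r add0r subrr.
rewrite big_ord_recr/= mulrDr IH.
have -> : N.+1%:R * x = (N%:R * x + x / 2) + x / 2 by rewrite -natr1; field.
set a := N%:R * x + x / 2; set b := x / 2.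
have -> : sin a = sin ((a + b) - b) by rewrite addrK.
by rewrite (sinB (a + b)) (sinD (a + b)); ring.
Qed.

End TrigBounds.

Section CharacteristicFunction.
Variable R : realType.

Definition charf (T : finType) (q : law R T) (z : T -> R) (l : R) : R :=
  expect q (fun t => cos (l * z t)).

(* [exp (- |l|^p)] is the characteristic function of the p-stable law; laws
   with this property on a long interval play the role of that law. *)
Definition stable_approx (T : finType) (q : law R T) (z : T -> R) (p Lam eta : R) :=
  forall l, 0 <= l <= Lam -> `|charf q z l - expR (- (l `^ p))| <= eta.

(* The test function is [c^2 (1 + c) / 2] with [c = cos (4 x)], which is
   nonnegative and close to 1 near 0. *)
Lemma stable_small_ball (T : finType) (q : law R T) (z : T -> R) (p Lam eta : R) :
  1 <= p -> 12 <= Lam -> eta <= 100^-1 -> stable_approx q z p Lam eta ->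
  prob q (fun t => `|z t| <= 40^-1) <= 9 / 20.
Proof.
move=> p1 Lam12 eta1 H.
have small (l : R) : 4 <= l -> l <= 12 -> charf q z l <= 21 / 100.
  move=> l4 l12; have /(_ l) := H; rewrite (le_trans l12 Lam12).
  have -> : 0 <= l by lra.
  move=> /(_ isT); rewrite ler_norml => /andP[_].
  have : expR (- (l `^ p)) <= 1 / 5.
    have : l <= l `^ p by rewrite le1r_powR//; lra.
    move=> lp; have := expR_ge1Dx (l `^ p); rewrite expRN div1r => h.
    by rewrite lef_pV2 ?posrE ?expR_gt0//; lra.
  by lra.
(* The frequencies 4, 8, 12 turn the expectation into values of [charf], all at most 21/100; the
   factor 52/50 lifts the function to at least 1 when [|z t| <= 1/40]. Any final bound below 1/2
   would keep the median away from 0. *)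
pose f t := 52 / 50 * (4^-1 * (1 + 3 / 2 * cos (4 * z t) + cos (8 * z t) + 2^-1 * cos (12 * z t))).
have fE t : f t = 52 / 50 * (cos (4 * z t) ^+ 2 * (1 + cos (4 * z t)) / 2).
  have E8 : cos (8 * z t) = 2 * cos (4 * z t) ^+ 2 - 1.
    have -> : 8 * z t = (4 * z t) *+ 2 by rewrite -mulr_natr; ring.
    by rewrite cos_mulr2n -[in LHS]mulr_natl.
  have E12 : cos (12 * z t) = 2 * cos (4 * z t) * cos (8 * z t) - cos (4 * z t).
    have := cosM (8 * z t) (4 * z t).
    have -> : 8 * z t + 4 * z t = 12 * z t by ring.
    have -> : 8 * z t - 4 * z t = 4 * z t by ring.
    lra.
  by rewrite /f E12 E8; field.
apply: (@le_trans _ _ (expect q f)).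
  apply: prob_le_expect => t; rewrite fE; have := cos_geN1 (4 * z t).
    by move=> c1; rewrite mulr_ge0// mulr_ge0// mulr_ge0 ?sqr_ge0//; lra.
  rewrite ler_norml => _ /andP[z1 z2].
  have y2 : (4 * z t) ^+ 2 <= 1 / 100 by nra.
  have c1 : 199 / 200 <= cos (4 * z t) by have := cos_ge (4 * z t); lra.
  have c2 : 99 / 100 <= cos (4 * z t) ^+ 2 by nra.
  have : 98 / 100 * 2 <= cos (4 * z t) ^+ 2 * (1 + cos (4 * z t)) by nra.
  lra.
rewrite /f expectZ expectZ !expectD !expectZ expect_cst.
have h4 : charf q z 4 <= 21 / 100 by apply: small; lra.
have h8 : charf q z 8 <= 21 / 100 by apply: small; lra.
have h12 : charf q z 12 <= 21 / 100 by apply: small; lra.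
move: h4 h8 h12; rewrite /charf; lra.
Qed.

(** A discrete form of the truncation inequality: the average of [1 - cos (l x)] over equally spaced
    [l] in [(0, 8 / B]] is at least 1/2 once [|x| > B], while its expectation is at most
    [8 / B + eta] because [1 - exp (- l^p) <= l^p <= l] for [l <= 1]. *)
Lemma stable_tail (T : finType) (q : law R T) (z : T -> R) (p Lam eta B : R) :
  1 <= p -> 8 <= B -> 8 / B <= Lam -> stable_approx q z p Lam eta ->
  prob q (fun t => B < `|z t|) <= 2 * (8 / B + eta).
Proof.
move=> p1 B8 LB H.
have B0 : 0 < B by lra.
set l0 := 8 / B; have l00 : 0 < l0 by rewrite divr_gt0.
have l01 : l0 <= 1 by rewrite ler_pdivrMr// mul1r.
(* [N] dominates [l0 * |z t|] for every outcome of the finite space, so the angle [th] below is at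
   most 1 and [sin (th / 2)] is comparable to [th]. *)
pose N := (Num.truncn (l0 * \sum_t `|z t|)).+1.
have N0 : 0 < N%:R :> R by rewrite ltr0n.
have zN t : l0 * `|z t| <= N%:R.
  apply: le_trans (ltW (truncnS_gt _)); rewrite ler_wpM2l ?(ltW l00)//.
  by rewrite (bigD1 t)//= lerDl sumr_ge0.
pose S x := N%:R^-1 * \sum_(j < N) cos (j.+1%:R * (l0 / N%:R) * x).
have S1 x : S x <= 1.
  rewrite /S mulrC ler_pdivrMr// mul1r -[in leRHS](card_ord N) -sum1_card natr_sum.
  by apply: ler_sum => j _; exact: cos_le1.
have Shalf x : B < `|x| -> l0 * `|x| <= N%:R -> S x <= 2^-1.
  move=> Bx lxN; pose th := l0 / N%:R * `|x|.
  have -> : S x = N%:R^-1 * \sum_(j < N) cos (j.+1%:R * th).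
    congr (_ * _); apply: eq_bigr => j _.
    rewrite -[LHS]cos_norm normrM /th [in RHS]mulrA; congr (cos (_ * _)).
    by apply: ger0_norm; apply: mulr_ge0 => //; apply: divr_ge0 => //; apply: ltW.
  have th1 : th <= 1 by rewrite /th mulrAC ler_pdivrMr// mul1r.
  have th8 : 8 <= N%:R * th.
    rewrite /th mulrA mulrCA divff ?gt_eqF// mulr1 /l0 mulrAC ler_pdivlMr// ler_pM2l//.
    exact: ltW.
  have th0 : 0 < th by rewrite -(pmulr_rgt0 _ N0); lra.
  have := dirichlet_kernel N th; have := sin_le1 (N%:R * th + th / 2).
  have := @sin_ge _ (th / 2); have -> : 0 <= th / 2 by lra.
  move=> /(_ isT); set s := sin (th / 2); set D := \sum_(j < N) _ => sth ss E.
  have s0 : th / 4 <= s by nra.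
  have D1 : D <= 4 / th.
    rewrite ler_pdivlMr//; have [D0|/ltW D0] := leP 0 D; nra.
  rewrite mulrC ler_pdivrMr//; apply: (le_trans D1).
  by rewrite ler_pdivrMr//; lra.
apply: (@le_trans _ _ (expect q (fun t => 2 * (1 - S (z t))))).
  apply: prob_le_expect => t; first by have := S1 (z t); lra.
  by move=> /Shalf/(_ (zN t)); lra.
rewrite expectZ ler_pM2l// expectB expect_cst expectZ expect_sum.
rewrite lerBlDl -lerBlDr mulrC ler_pdivlMr// mulr_natr.
rewrite -[in leLHS](card_ord N) -sumr_const; apply: ler_sum => j _.
have jN : 0 <= j.+1%:R * (l0 / N%:R) <= l0.
  apply/andP; split; first by apply: mulr_ge0 => //; apply: divr_ge0 => //; apply: ltW.
  by rewrite mulrA ler_pdivrMr// mulrC ler_pM2l// ler_nat.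
set l := _ * _ in jN *; case/andP: jN => jN0 jN1.
have := H l; rewrite jN0 (le_trans jN1)// => /(_ isT).
rewrite ler_norml => /andP[+ _]; rewrite /charf.
have : l `^ p <= l.
  have [->|l_neq0] := eqVneq l 0; first by rewrite powR0//; lra.
  by rewrite ge1r_powR// lt0r l_neq0 jN0 (le_trans jN1).
have := expR_ge1Dx (- (l `^ p)); lra.
Qed.
End CharacteristicFunction.

(** * Functions whose expectation depends stably on the characteristic function *)

Section CosDetermined.
Variable R : realType.
Implicit Types (F G : R -> R) (w mu : R).

Definition charf_close (Lam eta : R) (T1 T2 : finType) (q1 : law R T1) (z1 : T1 -> R)
    (q2 : law R T2) (z2 : T2 -> R) :=
  forall l, 0 <= l <= Lam -> `|charf q1 z1 l - charf q2 z2 l| <= eta.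

(** The spaces, laws and variables are quantified inside, so that [Lam] and [K] can be fixed before
    any law is constructed. *)
Definition expect_lipschitz (Lam K : R) F :=
  forall eta (T1 T2 : finType) (q1 : law R T1) (z1 : T1 -> R)
      (q2 : law R T2) (z2 : T2 -> R),
    charf_close Lam eta q1 z1 q2 z2 ->
    `|expect q1 (F \o z1) - expect q2 (F \o z2)| <= K * eta.

Definition charf_determined F :=
  exists Lam K : R, [/\ 0 <= Lam, 0 <= K & expect_lipschitz Lam K F].

(* Stability under multiplication by cosines is what makes an induction
   along products of cosines go through. *)
Definition cos_determined F := forall mu, charf_determined (fun x => F x * cos (mu * x)).

Lemma charf_close_sub Lam Lam' eta (T1 T2 : finType) (q1 : law R T1) (z1 : T1 -> R)
    (q2 : law R T2) (z2 : T2 -> R) :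
  Lam <= Lam' -> charf_close Lam' eta q1 z1 q2 z2 -> charf_close Lam eta q1 z1 q2 z2.
Proof. by move=> LL H l /andP[l0 lL]; apply: H; rewrite l0 (le_trans lL). Qed.

Lemma charf_determined_ext F G : F =1 G -> charf_determined F -> charf_determined G.
Proof. by move=> /funext ->. Qed.

Lemma charf_determinedD F G : charf_determined F -> charf_determined G ->
  charf_determined (fun x => F x + G x).
Proof.
move=> [L1 [K1 [L10 K10 H1]]] [L2 [K2 [L20 K20 H2]]].
exists (L1 + L2), (K1 + K2); split; rewrite ?addr_ge0// => eta T1 T2 q1 z1 q2 z2 H.
have h1 := H1 eta _ _ q1 z1 q2 z2 (charf_close_sub (_ : L1 <= L1 + L2) H).
have h2 := H2 eta _ _ q1 z1 q2 z2 (charf_close_sub (_ : L2 <= L1 + L2) H).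
rewrite !expectD opprD addrACA mulrDl (le_trans (ler_normD _ _))// lerD//.
  by rewrite h1// lerDl.
by rewrite h2// lerDr.
Qed.

Lemma charf_determinedZ (c : R) F : charf_determined F -> charf_determined (fun x => c * F x).
Proof.
move=> [L [K [L0 K0 H]]]; exists L, (`|c| * K); split; rewrite ?mulr_ge0//.
move=> eta T1 T2 q1 z1 q2 z2 h.
by rewrite !expectZ -mulrBr normrM -mulrA ler_wpM2l// H.
Qed.

Lemma cos_determined1 : cos_determined (fun=> 1).
Proof.
move=> mu; exists `|mu|, 1; split=> // eta T1 T2 q1 z1 q2 z2 /(_ `|mu|).
rewrite normr_ge0 lexx => /(_ isT); rewrite mul1r.
have E (T : finType) (q : law R T) z : charf q z `|mu| =
    expect q ((fun x => 1 * cos (mu * x)) \o z).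
  apply: eq_expect => t /=; rewrite mul1r -[LHS]cos_norm -[RHS]cos_norm.
  by rewrite !normrM normr_id.
by rewrite !E.
Qed.

Lemma cos_determinedD F G : cos_determined F -> cos_determined G ->
  cos_determined (fun x => F x + G x).
Proof.
move=> hF hG mu; apply: charf_determined_ext (charf_determinedD (hF mu) (hG mu)).
by move=> x; rewrite mulrDl.
Qed.

Lemma cos_determinedZ (c : R) F : cos_determined F -> cos_determined (fun x => c * F x).
Proof.
move=> hF mu; apply: charf_determined_ext (charf_determinedZ c (hF mu)).
by move=> x; rewrite mulrA.
Qed.

Lemma cos_determined_cosM w F : cos_determined F ->
  cos_determined (fun x => cos (w * x) * F x).
Proof.
move=> hF mu.
have := charf_determinedZ 2^-1 (charf_determinedD (hF (w + mu)) (hF (w - mu))).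
apply: charf_determined_ext => x.
by rewrite mulrAC cosM -mulrDl -mulrBl; ring.
Qed.

Lemma cos_determined_prod w (N : nat) (f : 'I_N -> bool) :
  cos_determined (fun x => \prod_i
    (if f i then (1 + cos (w * x)) / 2 else 1 - (1 + cos (w * x)) / 2)).
Proof.
elim: N f => [|N IH] f.
  by move=> mu; apply: charf_determined_ext (cos_determined1 mu) => x; rewrite big_ord0.
have {}IH := IH (fun i => f (lift ord0 i)).
(* Both kinds of factor have the form [(1 + e cos (w x)) / 2]. *)
pose e : R := if f ord0 then 1 else -1.
have := cos_determinedD (cos_determinedZ 2^-1 IH)
  (cos_determinedZ (e / 2) (cos_determined_cosM w IH)).
move=> H mu; apply: charf_determined_ext (H mu) => x.
by rewrite big_ord_recl /e; case: (f ord0) => /=; field.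
Qed.

Lemma charf_determined_uniform (I : finType) (F : I -> R -> R) :
  (forall i, charf_determined (F i)) ->
  exists Lam K : R, [/\ 0 <= Lam, 0 <= K & forall i, expect_lipschitz Lam K (F i)].
Proof.
move=> /fin_all_exists[Lam] /fin_all_exists[K] H.
exists (\sum_i Lam i), (\sum_i K i); split.
- by apply: sumr_ge0 => i _; case: (H i).
- by apply: sumr_ge0 => i _; case: (H i).
move=> i eta T1 T2 q1 z1 q2 z2 h; have [L0 K0 Hi] := H i.
have eta0 : 0 <= eta.
  by apply: le_trans (h 0 _) => //; rewrite lexx sumr_ge0// => j _; case: (H j).
apply: (@le_trans _ _ (K i * eta)).
  apply: Hi; apply: charf_close_sub h.
  by rewrite (bigD1 i)//= lerDl sumr_ge0// => j _; case: (H j).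
by rewrite ler_wpM2r// (bigD1 i)//= lerDl sumr_ge0// => j _; case: (H j).
Qed.

End CosDetermined.

(** * Bernstein approximation of a threshold by coin tossing *)

Section Bernoulli.
Variables (R : realType) (u : R) (u0 : 0 <= u) (u1 : u <= 1).

Let w (b : bool) := if b then u else 1 - u.
Let w_ge0 b : 0 <= w b. Proof. by case: b; rewrite /= ?subr_ge0. Qed.
Let w_sum : \sum_b w b = 1. Proof. by rewrite big_bool /= addrC subrK. Qed.

Definition coin_law : law R bool := Law w_ge0 w_sum.

Lemma prob_coin : prob coin_law id = u.
Proof. by rewrite /prob /expect big_bool /= mulr1 mulr0 addr0. Qed.

Lemma prob_coinN : prob coin_law negb = 1 - u.
Proof. by rewrite /prob /expect big_bool /= mulr1 mulr0 add0r. Qed.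

End Bernoulli.

Section StepPolynomial.
Variable R : realType.

(* The Bernstein polynomial of the indicator of [[c, 1]]. *)
Definition bernstein_step (N : nat) (c u : R) : R :=
  \sum_(f : {ffun 'I_N -> bool} | N%:R * c <= #|[set i | f i]%SET|%:R)
    \prod_i (if f i then u else 1 - u).

(** Read as the probability of at least [N c] heads among [N] coins of bias [u], the polynomial
    inherits an exponential approximation rate from Chernoff's bound. *)
Lemma bernstein_stepE N (c u : R) (u0 : 0 <= u) (u1 : u <= 1) :
  bernstein_step N c u =
  prob (iid (coin_law u0 u1) N) (fun f => N%:R * c <= #|[set i | f i]%SET|%:R).
Proof.
rewrite /prob /expect /bernstein_step big_mkcond; apply: eq_bigr => f _.
by case: ifP => _; rewrite ?mulr0 ?mulr1.
Qed.

Lemma bernstein_step_ge0 N (c u : R) : 0 <= u -> u <= 1 -> 0 <= bernstein_step N c u.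
Proof. by move=> u0 u1; rewrite (bernstein_stepE N c u0 u1) prob_ge0. Qed.

Lemma bernstein_step_le1 N (c u : R) : 0 <= u -> u <= 1 -> bernstein_step N c u <= 1.
Proof. by move=> u0 u1; rewrite (bernstein_stepE N c u0 u1) prob_le1. Qed.

Lemma bernstein_step_small N (c g u : R) : 0 <= u -> 0 <= g -> g <= 1 -> u <= 1 ->
  u <= c - g -> bernstein_step N c u <= expR (- (N%:R * (g ^+ 2 / 8))).
Proof.
move=> u0 g0 g1 u1 uc; rewrite (bernstein_stepE N c u0 u1).
have := @iid_count_tail _ _ (coin_law u0 u1) N id (c - g) g.
by rewrite prob_coin subrK => /(_ uc g0); apply; lra.
Qed.

Lemma bernstein_step_big N (c g u : R) : 0 <= u -> 0 <= g -> g <= 1 -> u <= 1 ->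
  c + g <= u -> 1 - expR (- (N%:R * (g ^+ 2 / 8))) <= bernstein_step N c u.
Proof.
move=> u0 g0 g1 u1 uc; rewrite (bernstein_stepE N c u0 u1).
have := @iid_count_tail _ _ (coin_law u0 u1) N negb (1 - c - g) g.
rewrite prob_coinN subrK => H.
rewrite lerBlDr -lerBlDl -probC; apply: le_trans (H _ g0 _); try lra.
apply: prob_sub => f; rewrite -ltNge => /ltW h.
rewrite mulrBr mulr1 lerBlDr -lerBlDl; apply: le_trans h.
rewrite lerBlDr -natrD ler_nat; have := cardsC [set i | f i]%SET.
rewrite card_ord => {1}<-; rewrite leq_add2l; apply: subset_leq_card.
by apply/fintype.subsetP => i; rewrite !inE.
Qed.

End StepPolynomial.

Section Comparison.
Variable R : realType.

(** A quantitative form of the continuity theorem. As [U x = (1 + cos (x / L)) / 2] decreases on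
    [[0, L]], the event [|x| <= t] is a threshold event for [U x], and a Bernstein polynomial in [U]
    is a finite sum of products of cosines. Monotonicity may fail beyond [L], whence the tail
    term. *)
Lemma prob_compare (L s del : R) : 0 < L -> 0 < s -> 0 < del ->
  exists Lam eta : R, [/\ 0 < Lam, 0 < eta & forall (T1 T2 : finType) (q1 : law R T1) (z1 : T1 -> R)
      (q2 : law R T2) (z2 : T2 -> R) (t : R),
    charf_close Lam eta q1 z1 q2 z2 -> 0 <= t -> t + s <= L ->
    prob q1 (fun a => `|z1 a| <= t) <=
      prob q2 (fun a => `|z2 a| <= t + s) + prob q2 (fun a => L < `|z2 a|) + del].
Proof.
move=> L0 s0 del0.
have pi2 := @pi_ge2 R.
pose w := L^-1; have w0 : 0 < w by rewrite invr_gt0.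
have [sL|sL] := leP s L; last first.
  by exists 1, 1; split=> // T1 T2 q1 z1 q2 z2 t _ t0; lra.
have ws1 : w * s <= 1 by rewrite mulrC ler_pdivrMr// mul1r.
have ws0 : 0 < w * s by rewrite mulr_gt0.
(* [U t - U (t + s)] is a product of two sines, each at least [sin (w s / 2)], hence at least [2 g]
   for every [t]; the threshold [c] halfway leaves [g] on both sides. *)
pose g := sin (w * s / 2) ^+ 2 / 2.
have sg0 : 0 < sin (w * s / 2) by apply: sin_gt0_pi; apply/andP; split; lra.
have g0 : 0 < g by rewrite divr_gt0// exprn_gt0.
have g1 : g <= 1 by have := sin_le1 (w * s / 2); rewrite /g; nra.
pose U x := (1 + cos (w * x)) / 2.
have U0 x : 0 <= U x by have := cos_geN1 (w * x); rewrite /U; lra.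
have U1 x : U x <= 1 by have := cos_le1 (w * x); rewrite /U; lra.
have Unorm x : U x = U `|x|.
  by rewrite /U -(cos_norm (w * x)) normrM (ger0_norm (ltW w0)).
have Udecr (x y : R) : 0 <= x -> x <= y -> y <= L -> U y <= U x.
  move=> x0 xy yL; rewrite /U ler_pM2r// lerD2l.
  have wx : 0 <= w * x by rewrite mulr_ge0// ltW.
  have wxy : w * x <= w * y by rewrite ler_pM2l.
  have wy : w * y <= 1 by rewrite mulrC ler_pdivrMr// mul1r.
  have := @ltr_cos R (w * y) (w * x); rewrite !in_itv/=.
  have -> : 0 <= w * y <= pi by apply/andP; split; lra.
  have -> : 0 <= w * x <= pi by apply/andP; split; lra.
  by move=> /(_ isT isT); rewrite !ltNge => /(congr1 negb); rewrite !negbK => ->.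
have Ugap (t : R) : 0 <= t -> t + s <= L -> U (t + s) + 2 * g <= U t.
  move=> t0 tL.
  have wt : 0 <= w * t by rewrite mulr_ge0// ltW.
  have wy : w * t + w * s <= 1 by rewrite -mulrDr mulrC ler_pdivrMr// mul1r.
  have : cos (w * t) - cos (w * (t + s)) = 2 * sin (w * t + w * s / 2) * sin (w * s / 2).
    set a := w * t + _; set b := w * s / 2.
    have -> : w * (t + s) = a + b by rewrite /a /b; field.
    have -> : w * t = a - b by rewrite addrK.
    have cc (x y : R) : cos (x - y) - cos (x + y) = 2 * sin x * sin y by rewrite cosB cosD; ring.
    exact: cc.
  have : sin (w * s / 2) <= sin (w * t + w * s / 2).
    have := @ltr_sin R (w * t + w * s / 2) (w * s / 2); rewrite !in_itv/=.
    have p1 := @pihalf_ge1 R.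
    have -> : - (pi / 2) <= w * t + w * s / 2 <= pi / 2 by apply/andP; split; lra.
    have -> : - (pi / 2) <= w * s / 2 <= pi / 2 by apply/andP; split; lra.
    by move=> /(_ isT isT); rewrite !ltNge => /(congr1 negb); rewrite !negbK => ->; lra.
  rewrite /U /g; nra.
(* The error [del] is split in three: the approximation of the indicator on each side, and the
   change of law in between. *)
pose N := (Num.truncn (24 / (g ^+ 2 * del))).+1.
have eN : expR (- (N%:R * (g ^+ 2 / 8))) <= del / 3.
  have h : 3 / del <= N%:R * (g ^+ 2 / 8).
    have : 24 / (g ^+ 2 * del) <= N%:R by rewrite ltW// truncnS_gt.
    rewrite ler_pdivrMr ?mulr_gt0 ?exprn_gt0// => hh.
    rewrite ler_pdivrMr//; lra.
  rewrite expRN -[leRHS]invrK lef_pV2 ?posrE ?expR_gt0 ?invr_gt0 ?divr_gt0// invf_div.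
  by apply: le_trans h _; have := expR_ge1Dx (N%:R * (g ^+ 2 / 8)); lra.
pose W (f : {ffun 'I_N -> bool}) x := \prod_i (if f i then U x else 1 - U x).
have [Lam [K [Lam0 K0 HK]]] : exists Lam K : R,
    [/\ 0 <= Lam, 0 <= K & forall f, expect_lipschitz Lam K (W f)].
  apply: charf_determined_uniform => f.
  have := cos_determined_prod w f 0; apply: charf_determined_ext => x.
  by rewrite mul0r cos0 mulr1.
pose M : R := #|{ffun 'I_N -> bool}|%:R.
have MK : 0 <= M * K by rewrite mulr_ge0.
(* [M] counts the products of cosines, each of which contributes an error [K eta]; the added ones
   only secure positivity. *)
exists (Lam + 1), (del / 3 / (M * K + 1)); split; first by lra.
  by rewrite !divr_gt0//; lra.
move=> T1 T2 q1 z1 q2 z2 t H t0 tL.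
pose c := (U t + U (t + s)) / 2.
have gap := Ugap t t0 tL.
have step_diff : expect q1 (fun a => bernstein_step N c (U (z1 a))) <=
    expect q2 (fun a => bernstein_step N c (U (z2 a))) + del / 3.
  rewrite -lerBlDl /bernstein_step !expect_sum -sumrB.
  set eta := del / 3 / (M * K + 1) in H.
  have eta0 : 0 <= eta by rewrite !divr_ge0//; lra.
  have : M * (K * eta) <= del / 3.
    by rewrite mulrA /eta mulrCA -[leRHS]mulr1 ler_wpM2l ?divr_ge0 ?(ltW del0)// ler_pdivrMr; lra.
  apply: le_trans; rewrite big_mkcond.
  have -> : M * (K * eta) = \sum_(f : {ffun 'I_N -> bool}) K * eta.
    by rewrite sumr_const mulr_natl.
  apply: ler_sum => f _; case: ifP => _; last by rewrite mulr_ge0.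
  apply: le_trans (ler_norm _) _; apply: (HK f).
  by apply: charf_close_sub H; lra.
apply: (@le_trans _ _ (expect q1 (fun a => bernstein_step N c (U (z1 a)) + del / 3))).
  apply: expect_le => a; have [zt|_] /= := boolP (`|z1 a| <= t); last first.
    by rewrite addr_ge0 ?bernstein_step_ge0 ?divr_ge0 ?(ltW del0).
  have : c + g <= U (z1 a).
    apply: (@le_trans _ _ (U t)); first by rewrite /c; lra.
    by rewrite (Unorm (z1 a)); apply: Udecr => //; lra.
  move=> /(bernstein_step_big N (U0 _) (ltW g0) g1 (U1 _)). lra.
rewrite expectD expect_cst.
suff : expect q2 (fun a => bernstein_step N c (U (z2 a))) <=
  prob q2 (fun a => `|z2 a| <= t + s) + prob q2 (fun a => L < `|z2 a|) + del / 3 by lra.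
rewrite -(expect_cst q2 (del / 3)) /prob -!expectD; apply: expect_le => a.
have := bernstein_step_le1 N c (U0 (z2 a)) (U1 (z2 a)).
have [zt|zt] /= := leP `|z2 a| (t + s); first by case: (L < _) => /=; lra.
have [zL|zL] /= := ltP L `|z2 a|; first by lra.
have : U (z2 a) <= c - g.
  apply: (@le_trans _ _ (U (t + s))); last by rewrite /c; lra.
  by rewrite (Unorm (z2 a)); apply: Udecr; [lra|exact: ltW|].
by move=> /(bernstein_step_small N (U0 _) (ltW g0) g1 (U1 _)); lra.
Qed.

End Comparison.

(** * The Sibuya law and approximate stable laws *)

Section Sibuya.
Variables (R : realType) (a : R).
Hypotheses (a_ge : 2^-1 <= a) (a_lt1 : a < 1).

(* [1 - (1 - z)^a] is a power series with nonnegative coefficients summing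
   to 1; [sibuya_tail N] is the sum of its coefficients of index > N. *)
Definition sibuya_tail (N : nat) : R := \prod_(k < N) (1 - a / k.+1%:R).

Lemma sibuya_tailS N : sibuya_tail N.+1 = sibuya_tail N * (1 - a / N.+1%:R).
Proof. by rewrite /sibuya_tail big_ord_recr. Qed.

Let factor_ge0 N : 0 <= 1 - a / N.+1%:R.
Proof.
rewrite subr_ge0 ler_pdivrMr// mul1r (le_trans (ltW a_lt1))//.
by rewrite ler1n.
Qed.

Lemma sibuya_tail_ge0 N : 0 <= sibuya_tail N.
Proof. exact: prodr_ge0. Qed.

Lemma sibuya_tail_decr N : sibuya_tail N.+1 <= sibuya_tail N.
Proof.
rewrite sibuya_tailS ler_piMr ?sibuya_tail_ge0// lerBlDr lerDl divr_ge0//.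
by move: a_ge; lra.
Qed.

(** The bound [a >= 1/2] compares each factor with [1 - 1 / (2 k)], which gives decay of order
    [N^(-1/2)] uniformly in [a]; squaring avoids the root. *)
Lemma sibuya_tail_sqr N : sibuya_tail N ^+ 2 <= N.+1%:R^-1.
Proof.
elim: N => [|N IH]; first by rewrite /sibuya_tail big_ord0 expr1n invr1.
rewrite sibuya_tailS exprMn.
set x : R := N.+1%:R in IH *; have x1 : 1 <= x by rewrite ler1n.
have -> : N.+2%:R = x + 1 :> R by rewrite -natr1.
have h0 := factor_ge0 N; rewrite -/x in h0.
have h1 : 1 - a / x <= 1 - 2^-1 / x.
  by rewrite lerD2l lerN2 ler_pM2r// invr_gt0; lra.
apply: (@le_trans _ _ (x^-1 * (1 - 2^-1 / x) ^+ 2)).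
  by apply: ler_pM; rewrite ?sqr_ge0// lerXn2r// nnegrE// (le_trans h0).
have x0 : 0 < x by lra.
rewrite -[leRHS]mul1r ler_pdivlMr; last lra.
have -> : x^-1 * (1 - 2^-1 / x) ^+ 2 * (x + 1) = 1 - (3 * x - 1) / (4 * x ^+ 3).
  by field; rewrite gt_eqF.
rewrite lerBlDr lerDl divr_ge0//; first lra.
by rewrite mulr_ge0// exprn_ge0// ltW.
Qed.

Let c (k : nat) := sibuya_tail k - sibuya_tail k.+1.

Let c_ge0 k : 0 <= c k.
Proof. by rewrite subr_ge0 sibuya_tail_decr. Qed.

Let D (N : nat) (z : R) : R := 1 - \sum_(k < N) c k * z ^+ k.+1.

(** The function [(1 - z)^a] solves [a f + (1 - z) f' = 0]. The coefficients obey the corresponding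
    recurrence, so the truncation [D N] solves the equation up to a single monomial, whose
    nonnegative coefficient yields the monotonicity used below. *)
Let D_derive N : exists dD : R -> R, (forall z : R, is_derive z (1 : R) (D N) (dD z)) /\
  forall z, a * D N z + (1 - z) * dD z = a * sibuya_tail N * z ^+ N.
Proof.
elim: N => [|N [dD [dDE HD]]].
  exists (fun=> 0); split => z.
    rewrite (_ : D 0 = fun=> 1); first exact: is_derive_cst.
    by apply/funext => y; rewrite /D big_ord0 subr0.
  by rewrite /D big_ord0 /sibuya_tail big_ord0 subr0; ring.
have DS : D N.+1 = (fun z => D N z - c N * z ^+ N.+1).
  by apply/funext => z; rewrite /D big_ord_recr/= opprD addrA.
exists (fun z => dD z - c N * (N.+1%:R * z ^+ N)); split => z.
  have hX : is_derive z (1 : R) (fun y : R => y ^+ N.+1) (N.+1%:R * z ^+ N).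
    have := @is_deriveX R R id N.+1 z 1 1 (is_derive_id _ _).
    by rewrite exprfctE /GRing.scale/= mulr1.
  have := @is_deriveB R R R _ _ z 1 _ _ (dDE z) (@is_deriveZ R R R _ (c N) z 1 _ hX).
  by rewrite DS.
have e : c N * N.+1%:R = a * sibuya_tail N.
  have : N.+1%:R != 0 :> R by rewrite pnatr_eq0.
  by rewrite /c sibuya_tailS; set x := _%:R => x0; field.
have := HD z; rewrite DS sibuya_tailS /= => hz.
have -> : a * (D N z - c N * z ^+ N.+1) + (1 - z) * (dD z - c N * (N.+1%:R * z ^+ N)) =
   (a * D N z + (1 - z) * dD z) - a * c N * z ^+ N.+1 - (1 - z) * (c N * N.+1%:R) * z ^+ N by ring.
rewrite hz e exprS.
have : N.+1%:R != 0 :> R by rewrite pnatr_eq0.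
by rewrite /c sibuya_tailS; set x := _%:R => x0; field.
Qed.

Let D0 N : D N 0 = 1.
Proof. by rewrite /D big1 ?subr0// => k _; rewrite expr0n mulr0. Qed.

Let derive_inv (z : R) : z < 1 ->
  is_derive z (1 : R) (fun y => expR (- a * ln (1 - y))) (a * expR (- a * ln (1 - z)) / (1 - z)).
Proof.
move=> z1.
have h1 : is_derive z (1 : R) (fun y : R => 1 - y) (- 1).
  have := @is_deriveB R R R (fun=> 1) id z 1 0 1 (is_derive_cst _ _ _) (is_derive_id _ _).
  by rewrite sub0r.
have l0 : 0 < 1 - z by rewrite subr_gt0.
have h2 := @is_derive1_comp R (@ln R) (fun y => 1 - y) z _ _ (is_derive1_ln l0) h1.
have h3 := @is_deriveZ R R R _ (- a) z 1 _ h2.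
have := @is_derive1_comp R (@expR R) _ z _ _ (is_derive_expR _) h3.
rewrite /GRing.scale/= (_ : expR _ * _ = a * expR (- a * ln (1 - z)) / (1 - z))//.
by ring.
Qed.

Lemma monotone_from0 (f df : R -> R) (z : R) : 0 <= z ->
  (forall y, 0 <= y <= z -> is_derive y (1 : R) f (df y)) ->
  (forall y, 0 <= y <= z -> 0 <= df y) -> f 0 <= f z.
Proof.
move=> z0 fdf df0; rewrite -subr_ge0.
have [y||y yz ->] := @MVT_segment R f df 0 z z0.
- by rewrite in_itv/= => /andP[/ltW y0 /ltW yz]; apply: fdf; rewrite y0.
- apply: derivable_within_continuous => y; rewrite in_itv/= => /fdf yz.
  exact: ex_derive.
by rewrite mulr_ge0 ?subr_ge0// df0//; move: yz; rewrite in_itv.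
Qed.

(* Both bounds follow from the monotonicity of [D N] and of
   [D N - sibuya_tail N] after multiplication by [(1 - z)^(-a)]. *)
Let D_bounds N (z : R) : 0 <= z -> z <= 1 ->
  (1 - z) `^ a <= D N z <= (1 - z) `^ a + sibuya_tail N.
Proof.
move=> z0; rewrite le_eqVlt => /orP[/eqP ->|z1].
  (* At [z = 1] the integrating factor [(1 - z)^(-a)] is infinite, but there the sum telescopes. *)
  rewrite subrr powR0 ?gt_eqF//; last by move: a_ge; lra.
  have -> : D N 1 = sibuya_tail N.
    rewrite /D; under eq_bigr do rewrite expr1n mulr1.
    elim: N => [|N IH]; first by rewrite big_ord0 /sibuya_tail big_ord0 subr0.
    by rewrite big_ord_recr/= opprD addrA IH /c opprB addrC subrK.
  by rewrite sibuya_tail_ge0 add0r lexx.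
pose E y := expR (- a * ln (1 - y)).
have E0 : E 0 = 1 by rewrite /E subr0 ln1 mulr0 expR0.
have l0 : 0 < 1 - z by rewrite subr_gt0.
have EE : (1 - z) `^ a = (E z)^-1.
  by rewrite /powR gt_eqF// /E mulNr expRN invrK.
have [dD [dDE HD]] := D_derive N.
have t0 := sibuya_tail_ge0 N.
have pos y : 0 <= y <= z -> 0 < E y / (1 - y).
  by move=> /andP[_ yz]; rewrite divr_gt0 ?expR_gt0// subr_gt0 (le_lt_trans yz).
rewrite EE; apply/andP; split.
  rewrite -div1r ler_pdivrMr ?expR_gt0//.
  have := @monotone_from0 (fun y => D N y * E y)
    (fun y => E y / (1 - y) * (a * sibuya_tail N * y ^+ N)) z z0.
  rewrite D0 E0 mulr1; apply.
    move=> y /andP[_ yz]; have y1 := le_lt_trans yz z1.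
    have := @is_deriveM R R _ _ y 1 _ _ (dDE y) (derive_inv y1).
    rewrite /GRing.scale/= (_ : _ + _ = E y / (1 - y) * (a * sibuya_tail N * y ^+ N))//.
    by rewrite -HD /E; field; rewrite subr_eq0 gt_eqF.
  move=> y yz; rewrite mulr_ge0 ?(ltW (pos _ yz))// mulr_ge0 ?exprn_ge0//.
    by rewrite mulr_ge0//; move: a_ge; lra.
  by case/andP: yz.
rewrite -lerBlDr -[leRHS]div1r ler_pdivlMr ?expR_gt0// -lerN2.
have h : -1 <= - ((D N 0 - sibuya_tail N) * E 0) by rewrite D0 E0 mulr1; lra.
apply: (le_trans h).
apply: (@monotone_from0 (fun y => - ((D N y - sibuya_tail N) * E y))
    (fun y => E y / (1 - y) * (a * sibuya_tail N * (1 - y ^+ N))) z z0).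
  move=> y /andP[_ yz]; have y1 := le_lt_trans yz z1.
  have hB := @is_deriveB R R R _ _ y 1 _ _ (dDE y) (is_derive_cst (sibuya_tail N) _ _).
  have := @is_deriveN R R R _ y 1 _ (@is_deriveM R R _ _ y 1 _ _ hB (derive_inv y1)).
  rewrite /GRing.scale/= (_ : - (_ + _) = E y / (1 - y) * (a * sibuya_tail N * (1 - y ^+ N)))//.
  rewrite subr0.
  have -> : E y / (1 - y) * (a * sibuya_tail N * (1 - y ^+ N)) =
    E y / (1 - y) * (a * sibuya_tail N - a * sibuya_tail N * y ^+ N) by ring.
  rewrite -HD /E -[(D N - cst _) y]/(D N y - sibuya_tail N).
  by field; rewrite subr_eq0 gt_eqF.
move=> y yz; rewrite mulr_ge0 ?(ltW (pos _ yz))// mulr_ge0//.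
  by rewrite mulr_ge0//; move: a_ge; lra.
by case/andP: yz => y0 yz; rewrite subr_ge0 exprn_ile1// (le_trans yz) ?ltW.
Qed.

(* The mass of the truncated tail is moved to the exponent 0. *)
Let sibuya_weight N (k : 'I_N.+1) :=
  if unlift ord0 k is Some j then c j else sibuya_tail N.

Let sibuya_weight_ge0 N (k : 'I_N.+1) : 0 <= sibuya_weight k.
Proof. by rewrite /sibuya_weight; case: unliftP => *; rewrite ?c_ge0 ?sibuya_tail_ge0. Qed.

Let sibuya_weight_sumE N (f : nat -> R) :
  \sum_(k < N.+1) sibuya_weight k * f k =
  sibuya_tail N * f 0 + \sum_(k < N) c k * f k.+1.
Proof.
rewrite big_ord_recl /sibuya_weight unlift_none; congr (_ + _).
by apply: eq_bigr => k _; rewrite liftK.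
Qed.

Let sibuya_weight_sum N : \sum_(k < N.+1) sibuya_weight k = 1.
Proof.
under eq_bigr do rewrite -[sibuya_weight _]mulr1.
rewrite (sibuya_weight_sumE N (fun=> 1)) mulr1.
under eq_bigr do rewrite mulr1.
elim: N => [|N IH]; first by rewrite big_ord0 addr0 /sibuya_tail big_ord0.
by rewrite big_ord_recr/= -IH /c; ring.
Qed.

Definition sibuya_law N : law R 'I_N.+1 := Law (@sibuya_weight_ge0 N) (sibuya_weight_sum N).

Lemma sibuya_pgf N (z : R) : 0 <= z -> z <= 1 ->
  `|expect (sibuya_law N) (fun k => z ^+ k) - (1 - (1 - z) `^ a)| <= sibuya_tail N.
Proof.
move=> z0 z1; rewrite /expect (sibuya_weight_sumE N (fun k => z ^+ k)) expr0 mulr1.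
have := D_bounds N z0 z1; rewrite /D => /andP[h1 h2].
have t0 := sibuya_tail_ge0 N; rewrite ler_norml; apply/andP; split; lra.
Qed.

End Sibuya.

(** * From the Sibuya generating function to the exponent of a stable law *)

Section StableExponent.
Variable R : realType.

Lemma subr_expn_le (M : nat) (x y : R) : 0 <= x <= 1 -> 0 <= y <= 1 ->
  `|x ^+ M - y ^+ M| <= M%:R * `|x - y|.
Proof.
move=> /andP[x0 x1] /andP[y0 y1].
rewrite subrXX normrM mulrC ler_wpM2r// (le_trans (ler_norm_sum _ _ _))//.
rewrite -[in leRHS](card_ord M) -sum1_card natr_sum; apply: ler_sum => i _.
by rewrite ger0_norm ?mulr_ge0 ?exprn_ge0// mulr_ile1 ?exprn_ge0 ?exprn_ile1.
Qed.

Lemma expRN_ge (u : R) : 0 <= expR (- u) - (1 - u).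
Proof. by rewrite subr_ge0 expR_ge1Dx. Qed.

Lemma expRN_le (u : R) : 0 <= u -> expR (- u) - (1 - u) <= u ^+ 2.
Proof.
move=> u0; have u1 : 0 < 1 + u by lra.
have : expR (- u) <= (1 + u)^-1.
  by rewrite expRN lef_pV2 ?posrE ?expR_gt0// expR_ge1Dx.
have : (1 + u)^-1 <= 1 - u + u ^+ 2.
  by rewrite -[leLHS]mul1r ler_pdivrMr//; nra.
lra.
Qed.

Lemma expRN_lipschitz (x y : R) : 0 <= x -> x <= y ->
  `|expR (- x) - expR (- y)| <= y - x.
Proof.
move=> x0 xy; rewrite ger0_norm ?subr_ge0 ?ler_expR ?lerN2//.
have -> : expR (- y) = expR (- x) * expR (- (y - x)) by rewrite -expRD; congr expR; ring.
have h1 : expR (- x) <= 1 by rewrite expR_le1 oppr_le0.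
have h2 := expR_ge1Dx (- (y - x)); have h0 := expR_gt0 (- x).
by nra.
Qed.

(* With [x = l h], the power [(1 - (1 - cos x)^(p/2))^M] is approximately
   [exp (- M 2^(-p/2) h^p l^p)], hence the choice of [M]. *)
Lemma cos_power_stable (p Lam eta s : R) : 1 <= p -> p < 2 -> 0 < Lam -> 0 < eta -> 0 < s ->
  exists (M' M : nat), (0 < M')%N /\ forall l, 0 <= l <= Lam ->
    0 <= cos (l * (s / (2 * M'%:R))) /\
    `|(1 - (1 - cos (l * (s / (2 * M'%:R)))) `^ (p / 2)) ^+ M - expR (- (l `^ p))| <= eta.
Proof.
move=> p1 p2 Lam_gt0 eta0 s0.
wlog Lam1 : Lam Lam_gt0 / 1 <= Lam => [H|{Lam_gt0}].
  have [|/ltW L1] := leP 1 Lam; first exact: H.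
  have [M' [M [M0 h]]] := H 1 ltr01 (lexx _).
  by exists M', M; split=> // l /andP[l0 ll]; apply: h; rewrite l0 (le_trans ll).
have Lam_gt0 : 0 < Lam by lra.
(* The first bound keeps [x = l h] in [[0, 1]]. In the second, [Lam^4 h] pays for replacing
   [(1 - u)^M] by [exp (- M u)] and [2 Lam^4 h] for replacing [M u] by [l^p]. *)
pose hm := Num.min Lam^-1 (eta / (3 * Lam ^+ 4)).
have L4 : 0 < Lam ^+ 4 by apply: exprn_gt0; lra.
have hm0 : 0 < hm by rewrite lt_min invr_gt0 divr_gt0 ?mulr_gt0//; lra.
(* A step [h = s / (2 M')] makes [s] an integer multiple of the lattice spacing [2 h] of the walk
   endpoints, as the shift argument for unimodality requires. *)
pose M' := (Num.truncn (s / (2 * hm))).+1.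
have [h hE] : exists h, h = s / (2 * M'%:R) by exists (s / (2 * M'%:R)).
have M'0 : 0 < M'%:R :> R by rewrite ltr0n.
have h0 : 0 < h by rewrite hE divr_gt0// mulr_gt0.
have hhm : h <= hm.
  have : s / (2 * hm) <= M'%:R by rewrite ltW// truncnS_gt.
  rewrite hE !ler_pdivrMr ?mulr_gt0// => /le_trans; apply.
  by rewrite mulrCA [hm * _]mulrC mulrA.
have := hhm; rewrite le_min -div1r !ler_pdivlMr ?mulr_gt0//.
rewrite mulrC [h * (3 * _)]mulrC => /andP[hL heta].
have h1 : h <= 1 by nra.
pose k := h `^ p * (2^-1) `^ (p / 2).
have k0 : 0 < k by rewrite mulr_gt0// powR_gt0//.
have kh : k <= h.
  have a1 : h `^ p <= h by rewrite ge1r_powR// h0.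
  have a2 : (2^-1 : R) `^ (p / 2) <= 1.
    by rewrite -[leRHS](powRr0 (2^-1)); apply: ger_powR; lra.
  by have := powR_ge0 h p; have := powR_ge0 (2^-1) (p / 2); rewrite /k; nra.
pose M := Num.truncn k^-1.
have Mk1 : M%:R * k <= 1 by rewrite -ler_pdivlMr// div1r truncn_le ?invr_ge0 ?(ltW k0).
have Mk2 : 1 - k <= M%:R * k.
  have := truncnS_gt k^-1; rewrite -/M -natr1 -[k^-1]mul1r ltr_pdivrMr//; lra.
exists M', M; split=> // l /andP[l0 lL]; rewrite -hE.
have [x xE] : exists x, x = l * h by exists (l * h).
rewrite -xE.
have x0 : 0 <= x by rewrite xE mulr_ge0// ltW.
have x1 : x <= 1 by rewrite xE; apply: le_trans hL; rewrite ler_pM2r.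
have xLh : x ^+ 2 <= Lam ^+ 2 * h.
  have : l ^+ 2 <= Lam ^+ 2 by rewrite lerXn2r// nnegrE; lra.
  have : h ^+ 2 <= h by nra.
  by rewrite xE exprMn => a1 a2; apply: ler_pM; rewrite ?sqr_ge0.
have cx : 1 - x ^+ 2 / 2 <= cos x by exact: cos_ge.
have cx' : cos x <= 1 - x ^+ 2 / 2 * (1 - x ^+ 2 / 4).
  have := @sin_ge _ (x / 2); have -> : 0 <= x / 2 by lra.
  move=> /(_ isT) sx; rewrite cos_half.
  have : (x / 2 * (1 - (x / 2) ^+ 2 / 2)) ^+ 2 <= sin (x / 2) ^+ 2.
    rewrite lerXn2r// nnegrE; last by apply: le_trans sx; rewrite mulr_ge0//; nra.
    by rewrite mulr_ge0//; nra.
  set X := x / 2 => hX; have xX : x = 2 * X by rewrite /X; field.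
  rewrite xX; have : X ^+ 2 * (X ^+ 2) ^+ 2 >= 0 by rewrite mulr_ge0// ?sqr_ge0.
  by move: hX; rewrite exprMn; nra.
have c0 : 0 <= cos x by nra.
split=> //.
set u := (1 - cos x) `^ (p / 2).
pose v := l `^ p * k.
have a0 : 0 <= p / 2 by lra.
have vE : v = (x ^+ 2 / 2) `^ (p / 2).
  rewrite powRM ?sqr_ge0// -powR_mulrn// -powRrM (_ : 2 * (p / 2) = p); last by field.
  by rewrite xE powRM// ?(ltW h0)// -mulrA.
have lp0 : 0 <= l `^ p by exact: powR_ge0.
have v0 : 0 <= v by rewrite mulr_ge0// ltW.
have x20 : 0 <= x ^+ 2 by exact: sqr_ge0.
have x21 : x ^+ 2 <= 1 by nra.
have c1 := cos_le1 x.
have x2p : 0 <= x ^+ 2 / 2 by lra.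
have y0 : 0 < 1 - x ^+ 2 / 4 by lra.
have xy0 : 0 <= x ^+ 2 / 2 * (1 - x ^+ 2 / 4) by rewrite mulr_ge0// ltW.
have uv : u <= v by rewrite vE; apply: ge0_ler_powR => //; rewrite ?nnegrE; lra.
have vu : v * (1 - x ^+ 2 / 4) <= u.
  apply: (@le_trans _ _ ((x ^+ 2 / 2 * (1 - x ^+ 2 / 4)) `^ (p / 2))).
    rewrite powRM ?(ltW y0)// -vE ler_wpM2l//.
    by apply: ger1_powR; [apply/andP; split; lra|lra].
  by apply: ge0_ler_powR => //; rewrite ?nnegrE; lra.
have u0 : 0 <= u by exact: powR_ge0.
have lpL : l `^ p <= Lam ^+ 2.
  apply: (@le_trans _ _ (Lam `^ p)).
    by apply: ge0_ler_powR; rewrite ?nnegrE ?(ltW Lam_gt0)// (le_trans ler01).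
  by rewrite -powR_mulrn ?(ltW Lam_gt0)//; apply: ler_powR => //; exact: ltW.
have u1 : u <= 1.
  apply: (@le_trans _ _ (1 `^ (p / 2))); last by rewrite powR1.
  by apply: ge0_ler_powR; rewrite ?nnegrE; lra.
have Mv : M%:R * v <= l `^ p.
  by rewrite /v mulrCA ler_piMr.
have Mu : M%:R * u <= l `^ p by apply: le_trans Mv; rewrite ler_wpM2l.
have Mu' : l `^ p - M%:R * u <= l `^ p * (k + x ^+ 2).
  have : M%:R * v * (1 - x ^+ 2 / 4) <= M%:R * u by rewrite -mulrA ler_wpM2l.
  have : l `^ p * (1 - k) <= M%:R * v by rewrite /v mulrCA ler_wpM2l.
  set A := M%:R * v; set B := M%:R * u; set C := l `^ p => i1 i2.
  have : C * (1 - k) * (1 - x ^+ 2 / 4) <= A * (1 - x ^+ 2 / 4) by rewrite ler_wpM2r//; lra.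
  have : 0 <= C * (k * (x ^+ 2)) by rewrite mulr_ge0// mulr_ge0// ltW.
  have : 0 <= C * x ^+ 2 by rewrite mulr_ge0.
  by nra.
have M1 : `|(1 - u) ^+ M - expR (- (M%:R * u))| <= Lam ^+ 4 * h.
  rewrite -mulrN expRM_natl; apply: le_trans (subr_expn_le _ _ _) _.
  - by apply/andP; split; lra.
  - by rewrite expR_ge0 expR_le1 oppr_le0.
  rewrite -normrN opprB ger0_norm ?expRN_ge//.
  apply: (@le_trans _ _ (M%:R * u ^+ 2)); first by rewrite ler_wpM2l// expRN_le.
  apply: (@le_trans _ _ (l `^ p * v)).
    by rewrite expr2 mulrA; apply: ler_pM => //; exact: mulr_ge0.
  rewrite /v mulrA; apply: ler_pM => //; first exact: mulr_ge0.
    exact: ltW.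
  by rewrite (_ : Lam ^+ 4 = Lam ^+ 2 * Lam ^+ 2); [apply: ler_pM | ring].
have M2 : `|expR (- (M%:R * u)) - expR (- (l `^ p))| <= 2 * Lam ^+ 4 * h.
  apply: le_trans (expRN_lipschitz _ Mu) _; first exact: mulr_ge0.
  apply: (le_trans Mu'); apply: (@le_trans _ _ (Lam ^+ 2 * (h + Lam ^+ 2 * h))).
    apply: ler_pM => //; first by rewrite addr_ge0 ?sqr_ge0// ltW.
    by rewrite lerD.
  have : 1 <= Lam ^+ 2 by nra.
  have -> : Lam ^+ 4 = Lam ^+ 2 * Lam ^+ 2 by ring.
  set L2 := Lam ^+ 2 => hL2.
  have L20 : 0 <= L2 := le_trans ler01 hL2.
  have : 0 <= h * L2 * (L2 - 1) by rewrite mulr_ge0 ?subr_ge0// mulr_ge0// ltW.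
  by nra.
apply: le_trans (_ : Lam ^+ 4 * h + 2 * Lam ^+ 4 * h <= _); last by lra.
rewrite -[X in `|X|](subrKA (expR (- (M%:R * u)))).
by apply: le_trans (ler_normD _ _) _; apply: lerD.
Qed.

(** The [M]-th power of a generating function is that of a sum of [M] independent exponents, and
    [cos (l h) ^+ e] is the characteristic function of a walk of [e] steps; thus the law of [e] is
    the mixing law of the walks. *)
Lemma stable_mixture (p Lam eta s : R) : 1 <= p -> p < 2 -> 0 < Lam -> 0 < eta -> 0 < s ->
  exists (M' : nat) (K : finType) (q : law R K) (e : K -> nat), (0 < M')%N /\
    forall l, 0 <= l <= Lam ->
    `|expect q (fun k => cos (l * (s / (2 * M'%:R))) ^+ e k) - expR (- (l `^ p))| <= eta.
Proof.
move=> p1 p2 Lam0 eta0 s0.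
have eta20 : 0 < eta / 2 by lra.
have [M' [M [M'0 H]]] := cos_power_stable p1 p2 Lam0 eta20 s0.
have a1 : 2^-1 <= p / 2 by lra.
have a2 : p / 2 < 1 by lra.
(* The [M]-th power multiplies the truncation error, of order [N^(-1/2)], by at most [M]. *)
pose N := Num.truncn ((M%:R * 2 / eta) ^+ 2).
have tailN : M%:R * sibuya_tail (p / 2) N <= eta / 2.
  have h := sibuya_tail_sqr a1 a2 N; have t0 := sibuya_tail_ge0 a2 N.
  have hN : (M%:R * 2 / eta) ^+ 2 <= N.+1%:R by rewrite ltW// truncnS_gt.
  have N0 : 0 < N.+1%:R :> R by rewrite ltr0n.
  rewrite -(ler_pXn2r (_ : 0 < 2)%N) ?nnegrE ?mulr_ge0//; last exact: ltW.
  rewrite exprMn; apply: (@le_trans _ _ (M%:R ^+ 2 * N.+1%:R^-1)).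
    by rewrite ler_wpM2l// exprn_ge0.
  rewrite ler_pdivrMr//; apply: (@le_trans _ _ ((eta / 2) ^+ 2 * (M%:R * 2 / eta) ^+ 2)).
    by rewrite -exprMn (_ : eta / 2 * (M%:R * 2 / eta) = M%:R)//; field; rewrite gt_eqF.
  by rewrite ler_wpM2l// sqr_ge0.
exists M', {ffun 'I_M -> 'I_N.+1}, (iid (sibuya_law a1 a2 N) M),
  (fun t : {ffun 'I_M -> 'I_N.+1} => (\sum_i t i)%N).
split=> // l lL; have [c0 hl] := H l lL.
set c := cos _ in c0 hl *; have c1 : c <= 1 by exact: cos_le1.
set A := expect (sibuya_law a1 a2 N) (fun k => c ^+ k).
have -> : expect (iid (sibuya_law a1 a2 N) M) (fun t => c ^+ (\sum_i t i)) = A ^+ M.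
  transitivity (expect (iid (sibuya_law a1 a2 N) M) (fun t => \prod_i c ^+ t i)).
    by apply: eq_expect => t; rewrite prodrXr.
  by rewrite (expect_iid_prod _ (fun _ (k : 'I_N.+1) => c ^+ k)) prodr_const card_ord.
have A0 : 0 <= A <= 1.
  apply/andP; split; first by apply: sumr_ge0 => t _; rewrite mulr_ge0 ?weight_ge0 ?exprn_ge0.
  rewrite -(expect_cst (sibuya_law a1 a2 N) 1); apply: expect_le => t.
  exact: exprn_ile1.
have hA : `|A - (1 - (1 - c) `^ (p / 2))| <= sibuya_tail (p / 2) N by exact: sibuya_pgf.
rewrite -(subrKA ((1 - (1 - c) `^ (p / 2)) ^+ M)) (le_trans (ler_normD _ _))//.
rewrite (_ : eta = eta / 2 + eta / 2); last by field.
apply: lerD hl; apply: le_trans tailN; apply: le_trans (subr_expn_le _ A0 _) _.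
  have u0 : 0 <= (1 - c) `^ (p / 2) := powR_ge0 _ _.
  have : (1 - c) `^ (p / 2) <= 1.
    apply: (@le_trans _ _ (1 `^ (p / 2))); last by rewrite powR1.
    by apply: ge0_ler_powR; rewrite ?nnegrE; lra.
  by move=> u1; apply/andP; split; lra.
by rewrite ler_wpM2l.
Qed.

End StableExponent.

(** * Unimodality of mixtures of random walks *)

Section RandomWalk.
Variable R : realType.

Lemma leq_bin_half (n i j : nat) : (j <= i)%N -> (i.*2 <= n)%N -> ('C(n, j) <= 'C(n, i))%N.
Proof.
move=> /subnK <-; elim: (i - j)%N => // d IH; rewrite addSn => h.
apply: (leq_trans (IH _)); first by lia.
rewrite -(@leq_pmul2l (d + j).+1)// mul_bin_left leq_mul2r; apply/orP; right.
by lia.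
Qed.

Definition walk_mean (n : nat) (f : R -> R) : R :=
  \sum_(j < n.+1) 'C(n, j)%:R / 2 ^+ n * f (n%:R - 2 * j%:R).

Lemma sum_binS n (g : nat -> R) :
  \sum_(j < n.+2) 'C(n.+1, j)%:R * g j = \sum_(j < n.+1) 'C(n, j)%:R * (g j + g j.+1).
Proof.
rewrite big_ord_recl bin0.
under eq_bigr do rewrite lift0 binS natrD mulrDl.
rewrite big_split addrA -[1%N in X in X * _](bin0 n).
under [in RHS]eq_bigr do rewrite mulrDr.
rewrite [RHS]big_split /=; congr (_ + _).
have := @big_ord_recl _ 0 +%R n.+1 (fun j : 'I_n.+2 => 'C(n, j)%:R * g j).
rewrite big_ord_recr/= bin_small// mul0r addr0 => ->.
by congr (_ + _); apply: eq_bigr => j _; rewrite lift0.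
Qed.

Lemma walk_mean_cos n (x y : R) :
  walk_mean n (fun t => cos (x + t * y)) = cos x * cos y ^+ n.
Proof.
have walkE m (f : R -> R) : walk_mean m f =
    2 ^- m * \sum_(j < m.+1) 'C(m, j)%:R * f (m%:R - 2 * j%:R).
  rewrite /walk_mean mulr_sumr; apply: eq_bigr => j _.
  by rewrite mulrCA mulrA.
elim: n x => [|n IH] x.
  by rewrite walkE big_ord_recl big_ord0 bin0 /= expr0 !mulr0 subrr mul0r !addr0 mulr1 invr1 !mul1r.
rewrite walkE (sum_binS n (fun j => cos (x + (n.+1%:R - 2 * j%:R) * y))).
have -> : \sum_(j < n.+1) 'C(n, j)%:R *
     (cos (x + (n.+1%:R - 2 * j%:R) * y) + cos (x + (n.+1%:R - 2 * j.+1%:R) * y)) =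
   2 * cos y * \sum_(j < n.+1) 'C(n, j)%:R * cos (x + (n%:R - 2 * j%:R) * y).
  rewrite mulr_sumr; apply: eq_bigr => j _; rewrite mulrCA; congr (_ * _).
  have -> : x + (n.+1%:R - 2 * j%:R) * y = (x + (n%:R - 2 * j%:R) * y) + y.
    by rewrite -natr1; ring.
  have -> : x + (n.+1%:R - 2 * j.+1%:R) * y = (x + (n%:R - 2 * j%:R) * y) - y.
    by rewrite -!natr1; ring.
  by rewrite -mulrA [cos y * _]mulrC cosM; field.
have := IH x; rewrite walkE => IHx.
have -> : 2 ^- n.+1 = 2^-1 * 2 ^- n :> R by rewrite exprS invfM.
rewrite exprS [cos x * _]mulrCA -IHx; set S := \sum_(_ < _) _; set P := 2 ^- n.
by field.
Qed.

Lemma walk_mean_sym n (f : R -> R) : walk_mean n f = walk_mean n (fun t => f (- t)).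
Proof.
rewrite /walk_mean (reindex_inj rev_ord_inj); apply: eq_bigr => j _ /=.
have jn : (j <= n)%N by rewrite -ltnS.
rewrite subSS bin_sub//; congr (_ * f _).
by rewrite natrB//; ring.
Qed.

Lemma walk_meanD n (f g : R -> R) :
  walk_mean n (fun t => f t + g t) = walk_mean n f + walk_mean n g.
Proof. by rewrite /walk_mean -big_split; apply: eq_bigr => j _; rewrite mulrDr. Qed.

(** Moving an endpoint inwards by [s] adds [M] to its index [j]. As the new endpoint is still
    positive, [j + M] stays below [n / 2], where binomial coefficients increase. *)
Lemma walk_mean_shift n (M : nat) (h u s : R) : 0 < h -> 0 <= u -> s = 2 * h * M%:R ->
  walk_mean n (fun t => (u + s < h * t <= u + 2 * s)%R%:R) <=
  walk_mean n (fun t => (u < h * t <= u + s)%R%:R).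
Proof.
move=> h0 u0 sE.
pose b (i : nat) : R := 'C(n, i)%:R / 2 ^+ n * (u < h * (n%:R - 2 * i%:R) <= u + s)%R%:R.
have b0 i : 0 <= b i by rewrite !mulr_ge0// invr_ge0 exprn_ge0.
apply: (@le_trans _ _ (\sum_(j < n.+1) b (j + M)%N)).
  apply: ler_sum => j _; rewrite /b natrD.
  have -> : h * (n%:R - 2 * (j%:R + M%:R)) = h * (n%:R - 2 * j%:R) - s by rewrite sE; ring.
  have -> : (u + s < h * (n%:R - 2 * j%:R) <= u + 2 * s) =
    (u < h * (n%:R - 2 * j%:R) - s <= u + s).
    by rewrite ltrBrDr lerBlDr; congr (_ && (_ <= _)); ring.
  case: (boolP (u < h * (n%:R - 2 * j%:R) - s <= u + s)) => [/andP[hu _]|_]; last by rewrite !mulr0.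
  rewrite !mulr1 ler_pM2r ?invr_gt0 ?exprn_gt0// ler_nat leq_bin_half ?leq_addr//.
  have : 0 < h * (n%:R - 2 * j%:R) - s by apply: le_lt_trans hu.
  have -> : h * (n%:R - 2 * j%:R) - s = h * (n%:R - 2 * (j + M)%N%:R) by rewrite natrD sE; ring.
  rewrite pmulr_rgt0// subr_gt0 -mulrC -natrM ltr_nat; lia.
have -> : \sum_(j < n.+1) b (j + M)%N = \sum_(M <= i < n.+1 + M) b i.
  have := @big_addn _ 0 +%R 0 (n.+1 + M) M xpredT b.
  by rewrite add0n addnK big_mkord => ->.
have -> : walk_mean n (fun t => (u < h * t <= u + s)%R%:R) = \sum_(0 <= i < n.+1 + M) b i.
  rewrite /walk_mean (big_cat_nat _ (n := n.+1)) ?leq_addr//= big_mkord.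
  have -> : \sum_(n.+1 <= i < n.+1 + M) b i = 0.
    by rewrite big_nat big1// => i /andP[ni _]; rewrite /b bin_small// !mul0r.
  by rewrite addr0.
rewrite [leRHS](big_cat_nat _ (n := M)) ?leq_addl//= lerDr.
by apply: sumr_ge0.
Qed.

Lemma walk_mean_abs n (h a b : R) : 0 < h -> 0 <= a ->
  walk_mean n (fun t => (a < `|h * t| <= b)%R%:R) =
  2 * walk_mean n (fun t => (a < h * t <= b)%R%:R).
Proof.
move=> h0 a0.
have -> : walk_mean n (fun t => (a < `|h * t| <= b)%R%:R) =
  walk_mean n (fun t => (a < h * t <= b)%R%:R + (a < h * - t <= b)%R%:R).
  apply: eq_bigr => j _; congr (_ * _); set t := _ - _.
  rewrite mulrN; have [ht|ht] := leP 0 (h * t).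
    rewrite [a < - _]ltNge (le_trans _ a0) ?oppr_le0//= addr0.
    by rewrite ger0_norm.
  rewrite [a < h * t]ltNge (le_trans _ a0) ?(ltW ht)//= add0r.
  by rewrite ltr0_norm.
rewrite walk_meanD -(walk_mean_sym n (fun t => (a < h * t <= b)%R%:R)).
by rewrite mulr_natl mulr2n.
Qed.

End RandomWalk.

Section WalkLaw.
Variables (R : realType) (K : finType) (q : law R K) (e : K -> nat).

Let B := (\max_k e k)%N.
Let w (t : K * 'I_B.+1) : R := q t.1 * ('C(e t.1, t.2)%:R / 2 ^+ e t.1).

Let wE (f : K -> nat -> R) :
  \sum_t w t * f t.1 t.2 =
  expect q (fun k => \sum_(j < (e k).+1) 'C(e k, j)%:R / 2 ^+ e k * f k j).
Proof.
rewrite /expect -(pair_bigA _ (fun k (j : 'I_B.+1) => w (k, j) * f k j)) /=.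
apply: eq_bigr => k _; rewrite /w /= mulr_sumr.
have ekB : (e k <= B)%N by exact: (leq_bigmax k).
under eq_bigr do rewrite -mulrA.
rewrite -(big_mkord xpredT (fun j => q k * ('C(e k, j)%:R / 2 ^+ e k * f k j))).
rewrite (big_cat_nat _ (n := (e k).+1))//= big_mkord.
rewrite [X in _ + X = _](_ : _ = 0) ?addr0//.
by rewrite big_nat big1// => i /andP[ei _]; rewrite bin_small// !mul0r mulr0.
Qed.

Let w_ge0 t : 0 <= w t.
Proof. by rewrite !mulr_ge0 ?weight_ge0// invr_ge0 exprn_ge0. Qed.

Let w_sum : \sum_t w t = 1.
Proof.
under eq_bigr do rewrite -[w _]mulr1.
rewrite (wE (fun _ _ => 1)) -[RHS](expect_cst q); apply: eq_expect => k.
have := walk_mean_cos (e k) (0 : R) 0; rewrite !cos0 expr1n mulr1 => E; rewrite -[RHS]E.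
by apply: eq_bigr => j _; rewrite mulr0 addr0 cos0.
Qed.

Definition walk_law : law R (K * 'I_B.+1)%type := Law w_ge0 w_sum.

Definition walk_val (h : R) (t : K * 'I_B.+1) : R := h * ((e t.1)%:R - 2 * (nat_of_ord t.2)%:R).

Lemma expect_walk (h : R) (f : R -> R) :
  expect walk_law (f \o walk_val h) = expect q (fun k => walk_mean (e k) (fun t => f (h * t))).
Proof. exact: (wE (fun k j => f (h * ((e k)%:R - 2 * j%:R)))). Qed.

Lemma charf_walk (h l : R) :
  charf walk_law (walk_val h) l = expect q (fun k => cos (l * h) ^+ e k).
Proof.
rewrite /charf (expect_walk h (fun x => cos (l * x))); apply: eq_expect => k.
rewrite -[RHS]mul1r -cos0 -walk_mean_cos; apply: eq_bigr => j _.
by congr (_ * cos _); ring.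
Qed.

Lemma expect_walk_sin (h l : R) : expect walk_law (fun t => sin (l * walk_val h t)) = 0.
Proof.
rewrite (expect_walk h (fun x => sin (l * x))) -[RHS](expect_cst q); apply: eq_expect => k.
have := walk_mean_sym (e k) (fun t => sin (l * (h * t))).
have -> : walk_mean (e k) (fun t => sin (l * (h * - t))) =
    - walk_mean (e k) (fun t => sin (l * (h * t))).
  by rewrite /walk_mean -sumrN; apply: eq_bigr => j _; rewrite !mulrN sinN mulrN.
lra.
Qed.

Lemma prob_walk_decr (M : nat) (h u s : R) : 0 < h -> 0 <= u -> s = 2 * h * M%:R ->
  prob walk_law (fun t => u + s < `|walk_val h t| <= u + 2 * s) <=
  prob walk_law (fun t => u < `|walk_val h t| <= u + s).
Proof.
move=> h0 u0 sE; have s0 : 0 <= s by rewrite sE !mulr_ge0// ltW.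
rewrite /prob (expect_walk h (fun x => (u + s < `|x| <= u + 2 * s)%R%:R)).
rewrite (expect_walk h (fun x => (u < `|x| <= u + s)%R%:R)).
apply: expect_le => k; rewrite !walk_mean_abs ?addr_ge0// ler_pM2l//.
exact: walk_mean_shift sE.
Qed.

End WalkLaw.

(** Symmetry is recorded through the vanishing sine moments, which is all that sums need, and
    unimodality only at the scale [s], since the median is located on the grid of multiples of
    [s]. *)
Lemma unimodal_stable_approx (R : realType) (p Lam eta s : R) :
  1 <= p -> p < 2 -> 0 < Lam -> 0 < eta -> 0 < s ->
  exists (T : finType) (q : law R T) (z : T -> R), [/\ stable_approx q z p Lam eta,
    forall l, expect q (fun t => sin (l * z t)) = 0 & forall u, 0 <= u ->
      prob q (fun t => u + s < `|z t| <= u + 2 * s) <= prob q (fun t => u < `|z t| <= u + s)].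
Proof.
move=> p1 p2 Lam0 eta0 s0.
have [M [K [q [e [M0 H]]]]] := stable_mixture p1 p2 Lam0 eta0 s0.
have M0R : 0 < M%:R :> R by rewrite ltr0n.
exists _, (walk_law q e), (walk_val (s / (2 * M%:R))); split.
- by move=> l lL; rewrite charf_walk; exact: H.
- by move=> l; rewrite expect_walk_sin.
move=> u u0.
apply: (@prob_walk_decr _ _ q e M) => //; first by rewrite divr_gt0 ?mulr_gt0.
by field; rewrite gt_eqF.
Qed.

(** * Linear forms with a gap around the median *)

Section CharfSum.
Local Open Scope complex_scope.
Variables (R : realType) (T : finType) (q : law R T).

Let cis (x : R) : R[i] := cos x +i* sin x.

Let cis_sum (I : Type) (r : seq I) (F : I -> R) :
  cis (\sum_(i <- r) F i) = \prod_(i <- r) cis (F i).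
Proof.
apply: (big_morph cis) => [x y|]; rewrite /cis ?cos0 ?sin0//.
by rewrite cosD sinD; apply/eqP; rewrite eq_complex /= eqxx addrC mulrC [sin x * _]mulrC eqxx.
Qed.

(** This is the real part of the product formula for complex characteristic functions; vanishing
    sine moments make every factor real. *)
Lemma expect_cos_sum (n : nat) (F : 'I_n -> T -> R) :
  (forall i, expect q (fun t => sin (F i t)) = 0) ->
  expect (iid q n) (fun t => cos (\sum_i F i (t i))) =
  \prod_i expect q (fun t => cos (F i t)).
Proof.
move=> F0.
have E (i : 'I_n) : \sum_t (q t)%:C * cis (F i t) = (expect q (fun t => cos (F i t)))%:C.
  have -> : \sum_t (q t)%:C * cis (F i t) =
      (expect q (fun t => cos (F i t))) +i* (expect q (fun t => sin (F i t))).
    rewrite /expect; elim/big_rec3: _ => [//|t x y z _ ->].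
    by apply/eqP; rewrite eq_complex /= !mul0r subr0 addr0 !eqxx.
  by rewrite F0.
have Re_sum (I : finType) (G : I -> R[i]) : complex.Re (\sum_x G x) = \sum_x complex.Re (G x).
  by apply: (big_morph (@complex.Re R)) => // -[a b] [c d].
rewrite -[RHS]/(complex.Re (\prod_i expect q (fun t => cos (F i t)))%:C).
have -> : (\prod_i expect q (fun t => cos (F i t)))%:C = \prod_i \sum_t (q t)%:C * cis (F i t).
  by rewrite rmorph_prod; apply: eq_bigr => i _; rewrite E.
rewrite bigA_distr_bigA Re_sum; apply: eq_bigr => t _.
rewrite big_split -rmorph_prod -cis_sum /=.
by rewrite mul0r subr0.
Qed.

End CharfSum.

Section MedianGap.
Variables (R : realType) (T : finType) (q : law R T) (z : T -> R) (p Lam eta s : R) (r : nat).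
Hypotheses (p_ge1 : 1 <= p) (Lam_ge : 12 <= Lam) (eta_le : eta <= 100^-1)
  (z_stable : stable_approx q z p Lam eta)
  (s_gt0 : 0 < s) (s_le : s <= 120^-1) (r_ge : 128 <= r%:R * s)
  (z_decr : forall u, 0 <= u ->
     prob q (fun t => u + s < `|z t| <= u + 2 * s) <= prob q (fun t => u < `|z t| <= u + s)).

Let G (u : R) := prob q (fun t => `|z t| <= u).
Let d (j : nat) := G (j.+1%:R * s) - G (j%:R * s).

Let G_mono (u v : R) : u <= v -> G u <= G v.
Proof. by move=> uv; apply: prob_sub => t /le_trans; apply. Qed.

Let G_diff (u v : R) : u <= v -> G v - G u = prob q (fun t => u < `|z t| <= v).
Proof.
move=> uv; rewrite -expectB; apply: eq_expect => t.
have [zu|zu] /= := leP `|z t| u; first by rewrite (le_trans zu uv) subrr.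
by rewrite subr0.
Qed.

Let d_decr j : d j.+1 <= d j.
Proof.
have js : 0 <= j%:R * s by rewrite mulr_ge0// ltW.
have := z_decr js; rewrite /d.
have -> : j%:R * s + s = j.+1%:R * s by rewrite -natr1; ring.
have -> : j%:R * s + 2 * s = j.+2%:R * s by rewrite -!natr1; ring.
by rewrite -!G_diff// ler_pM2r// ler_nat.
Qed.

Let d_le i j : (i <= j)%N -> d j <= d i.
Proof. by move=> /subnK <-; elim: (j - i)%N => // k; apply: le_trans; rewrite addSn d_decr. Qed.

Let G_chord j m : G ((j + m)%N%:R * s) <= G (j%:R * s) + m%:R * d j.
Proof.
elim: m => [|m IH]; first by rewrite addn0 mul0r addr0.
have := d_le (leq_addr m j); rewrite addnS {1}/d -natr1; lra.
Qed.

Let G_r : 3 / 4 <= G (r%:R * s).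
Proof.
(* At 128 the tail is at most [2 (8 / 128 + 1 / 100)], which is below 1/4. *)
apply: le_trans (G_mono r_ge).
have := @stable_tail _ _ q z p Lam eta 128 p_ge1 _ _ z_stable.
have -> : prob q (fun t => 128 < `|z t|) = 1 - G 128.
  by rewrite -probC; apply: eq_expect => t; rewrite ltNge.
have a1 : (8 : R) <= 128 by lra.
have a2 : 8 / 128 <= Lam by move: Lam_ge; lra.
by move=> /(_ a1 a2); move: eta_le; lra.
Qed.

(* The increments [d] decrease, so [G] lies above its chords: near the
   median it grows at least as fast as it does on average up to [128]. *)
Lemma median_gap : exists i : nat, [/\ (2 < i)%N, (i <= r)%N, 40^-1 <= i%:R * s,
  prob q (fun t => `|z t| <= (i - 2)%N%:R * s) <= 1 / 2 - (4 * r%:R)^-1 &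
  1 / 2 + (4 * r%:R)^-1 <= prob q (fun t => `|z t| <= i.+1%:R * s)].
Proof.
have Gr := G_r.
have r0 : 0 < r%:R :> R.
  have h := r_ge; rewrite ltr0n lt0n; apply/eqP => r0; move: h; rewrite r0 mul0r; lra.
have r1 : 1 <= r%:R :> R by rewrite ler1n -(ltr0n R).
have [|i Gi imin] := @ex_minnP (fun i => 1 / 2 <= G (i%:R * s)).
  by exists r; lra.
have ir : (i <= r)%N by apply: imin; lra.
have i40 : 40^-1 <= i%:R * s.
  rewrite leNgt; apply/negP => /ltW /G_mono.
  have := stable_small_ball p_ge1 Lam_ge eta_le z_stable; rewrite -/(G _); move: Gi; lra.
have i2 : (2 < i)%N.
  rewrite -(ltr_nat R) -(ltr_pM2r s_gt0); move: s_le; lra.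
have rr : r%:R * (4 * r%:R)^-1 = 4^-1 :> R by field; rewrite gt_eqF.
set g := (4 * r%:R)^-1 in rr *.
exists i; split => //.
  rewrite -/(G _).
  have e1 : (i - 2).+1 = i.-1 by clear -i2; lia.
  have e2 : (i.-1 + (r - i.-1))%N = r by clear -ir; lia.
  have i12 : (i - 2 <= i.-1)%N by clear; lia.
  have lt_i1 : G (i.-1%:R * s) < 1 / 2.
    by rewrite ltNge; apply/negP => /imin; clear -i2; lia.
  (* From [i - 1] to [r] the function gains more than 1/4 in at most [r] decreasing increments. So
     the first of them, and a fortiori [d (i - 2)], is at least [1 / (4 r)]. *)
  have := G_chord i.-1 (r - i.-1); rewrite e2.
  have di0 : 0 <= d i.-1 by rewrite subr_ge0 G_mono// ler_pM2r// ler_nat.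
  have : (r - i.-1)%N%:R * d i.-1 <= r%:R * d i.-1 by rewrite ler_wpM2r// ler_nat leq_subr.
  have : d i.-1 <= d (i - 2)%N by exact: d_le.
  rewrite {2}/d e1 => h1 h2 h3.
  have : g <= d i.-1 by rewrite -(ler_pM2l r0); lra.
  lra.
rewrite -/(G _).
have e2 : (i + (r - i))%N = r by rewrite subnKC.
have := G_chord i (r - i); rewrite e2.
have di0 : 0 <= d i by rewrite subr_ge0 G_mono// ler_pM2r// ler_nat.
have : (r - i)%N%:R * d i <= r%:R * d i by rewrite ler_wpM2r// ler_nat leq_subr.
have -> : G (i.+1%:R * s) = G (i%:R * s) + d i by rewrite /d addrC subrK.
(* [G (i s)] may already exceed 1/2, which weakens the bound on [d i]; the sum still satisfies [r (G
   (i s) + d i) >= (r - 1) G (i s) + 3/4 >= r / 2 + 1/4]. *)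
move=> h1 h2; rewrite -(ler_pM2l r0); nra.
Qed.

End MedianGap.

Lemma prod_diff_le (R : realType) (n : nat) (x y : 'I_n -> R) (eta : R) :
  (forall i, `|x i| <= 1) -> (forall i, `|y i| <= 1) -> (forall i, `|x i - y i| <= eta) ->
  `|\prod_i x i - \prod_i y i| <= n%:R * eta.
Proof.
elim: n x y => [|n IH] x y x1 y1 xy; first by rewrite !big_ord0 subrr normr0 mul0r.
rewrite !big_ord_recl.
have -> : x ord0 * \prod_(i < n) x (lift ord0 i) - y ord0 * \prod_(i < n) y (lift ord0 i) =
  (x ord0 - y ord0) * \prod_(i < n) x (lift ord0 i) +
  y ord0 * (\prod_(i < n) x (lift ord0 i) - \prod_(i < n) y (lift ord0 i)) by ring.
rewrite -natr1 [leRHS]mulrDl mul1r addrC (le_trans (ler_normD _ _))// lerD//.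
  by rewrite normrM -[leRHS]mul1r; apply: ler_pM => //; exact: IH.
rewrite normrM -[leRHS]mulr1 ler_pM// normr_prod.
rewrite -[leRHS](expr1n _ n) -[in leRHS](card_ord n) -prodr_const ler_prod// => i _.
by rewrite normr_ge0 x1.
Qed.

Section StableSum.
Variables (R : realType) (T : finType) (q : law R T) (z : T -> R) (p Lam eta : R) (n : nat).
Hypotheses (p_ge1 : 1 <= p) (z_stable : stable_approx q z p Lam eta)
  (z_sin : forall l, expect q (fun t => sin (l * z t)) = 0).

Definition linear_form (y : 'I_n -> R) (t : {ffun 'I_n -> T}) : R := \sum_i y i * z (t i).

(** Stability: the exponents [(l |y i|)^p] add up to [l^p]. All [|y i|] are at most 1, so the
    frequencies [l |y i|] stay in the range where [z] is controlled. *)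
Lemma stable_sum (y : 'I_n -> R) : \sum_i `|y i| `^ p = 1 ->
  stable_approx (iid q n) (linear_form y) p Lam (n%:R * eta).
Proof.
move=> y1 l /andP[l0 lL].
have p0 : 0 < p by exact: lt_le_trans p_ge1.
have yi i : `|y i| <= 1.
  rewrite leNgt; apply/negP => yi1.
  have : `|y i| `^ p <= 1.
    by rewrite -y1 (bigD1 i)//= lerDl sumr_ge0// => j _; rewrite powR_ge0.
  by apply/negP; rewrite -ltNge (lt_le_trans yi1)// le1r_powR// ltW.
have -> : charf (iid q n) (linear_form y) l = \prod_i charf q z (l * `|y i|).
  rewrite /charf /linear_form.
  under eq_expect do rewrite mulr_sumr.
  rewrite (expect_cos_sum (q := q) (F := fun i t => l * (y i * z t))).
    apply: eq_bigr => i _; apply: eq_expect => t.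
    by rewrite -[LHS]cos_norm -[RHS]cos_norm !normrM normr_id mulrA.
  by move=> i; rewrite -[RHS](z_sin (l * y i)); apply: eq_expect => t; rewrite mulrA.
have -> : expR (- (l `^ p)) = \prod_i expR (- ((l * `|y i|) `^ p)).
  rewrite -expR_sum sumrN; congr expR; congr (- _).
  rewrite -[LHS]mulr1 -y1 mulr_sumr; apply: eq_bigr => i _.
  by rewrite powRM.
apply: prod_diff_le => i.
- rewrite ler_norml; apply/andP; split.
    by rewrite -[leLHS](expect_cst q); apply: expect_le => t; exact: cos_geN1.
  by rewrite -[leRHS](expect_cst q); apply: expect_le => t; exact: cos_le1.
- by rewrite ger0_norm ?expR_ge0// expR_le1 oppr_le0 powR_ge0.
- apply: z_stable; rewrite mulr_ge0//=; apply: le_trans lL.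
  by rewrite ler_piMr.
Qed.

End StableSum.

(** A form [<row, y>] with [y] of norm 1 is compared with one copy of [z]: both nearly have the
    p-stable characteristic function. Division by the grid median [i s] of [|z|] moves the gap to
    1. *)
Lemma stable_functional (R : realType) : exists2 K : R, 2 <= K &
  forall (p eps B : R) (n : nat), 1 <= p -> p < 2 -> 0 < eps -> eps < 1 -> K <= B ->
  exists (T : finType) (q : law R T) (S : T -> 'I_n -> R),
    forall y : 'I_n -> R, \sum_i `|y i| `^ p = 1 ->
    [/\ prob q (fun t => `|\sum_i S t i * y i| <= 1 - eps) <= 1 / 2 - eps / K,
        prob q (fun t => 1 + eps < `|\sum_i S t i * y i|) <= 1 / 2 - eps / K &
        prob q (fun t => B < `|\sum_i S t i * y i|) <= K / B].
Proof.
(* [8 * (120 * 129)] comes from a gap [1 / (8 r)] with [r <= 129 / s] and [s = eps / 120]; the bound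
   645 covers the tail at [B / 40], which is at most [2 (320 / B + eta)] with [eta <= 1 / B]. *)
have [K K640 K_ge] : exists2 K : R, 645 <= K & 8 * (120 * 129) <= K.
  by exists (8 * (120 * 129)); lra.
exists K => [|p eps B n p1 p2 eps0 eps1 BK]; first by lra.
have B320 : 320 <= B by lra.
have B0 : 0 < B by lra.
have K0 : 0 < K by lra.
(* Below the median the gap costs two grid steps and the change of law a third, and [3 s = eps / 40]
   is at most [eps] times the median. *)
have [s sE] : exists s, s = eps / 120 by exists (eps / 120).
have s0 : 0 < s by rewrite sE divr_gt0.
have s1 : s <= 120^-1 by rewrite sE; lra.
have [r r128 rs] : exists2 r : nat, 128 <= r%:R * s & r%:R * s <= 129.
  have h0 : 0 <= 128 / s by rewrite divr_ge0// ltW.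
  have := h0; rewrite -truncn_le; have := truncnS_gt (128 / s); rewrite -natr1.
  set r := Num.truncn _; rewrite ltr_pdivrMr// ler_pdivlMr// => h1 h2.
  by exists r.+1; rewrite -natr1; lra.
have r0 : 0 < r%:R :> R by rewrite -(pmulr_lgt0 _ s0); lra.
have r1 : 1 <= r%:R :> R by rewrite ler1n -(ltr0n R).
have [g gV] : exists g, g = r%:R^-1 :> R by exists r%:R^-1.
have g0 : 0 < g by rewrite gV invr_gt0.
have rg : r%:R * g = 1 by rewrite gV mulfV// gt_eqF.
have gE : (4 * r%:R)^-1 = g / 4 by rewrite invfM mulrC gV.
have gap : eps / K <= g / 8.
  rewrite ler_pdivrMr// -(ler_pM2l r0).
  have -> : r%:R * (g / 8 * K) = r%:R * g * (K / 8) by field.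
  by rewrite rg mul1r; move: rs; rewrite sE; lra.
(* Each tail beyond [L] then costs at most [g / 32]. With [del = g / 32], the gap [g / 4] keeps more
   than [g / 8]. *)
have [L [L0 L8 LE Lr]] : exists L, [/\ 0 < L, 8 <= L, 8 / L = g / (16 * 16) & (r%:R + 2) * s <= L].
  exists (8 * (16 * (16 * r%:R))); rewrite !mulr_gt0//; split=> //; first by lra.
    by rewrite gV; field; rewrite gt_eqF.
  nra.
have del0 : 0 < g / 32 by lra.
have [Lam0 [eta0 [Lam00 eta00 cmp]]] := prob_compare L0 s0 del0.
have [eta [eta_gt0 ea eb ec ed]] : exists eta,
    [/\ 0 < eta, eta <= eta0 / 2, eta <= 100^-1, eta <= g / 128 & eta <= B^-1].
  exists (Num.min (Num.min (eta0 / 2) (100^-1)) (Num.min (g / 128) B^-1)).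
  have e0 : 0 < eta0 / 2 by exact: divr_gt0.
  have g2 : 0 < g / 128 by exact: divr_gt0.
  by split; rewrite ?lt_min ?ge_min ?e0 ?g2 ?invr_gt0 ?B0 ?lexx ?orbT //= ltr0n.
have n1 : 0 < n.+1%:R :> R by rewrite ltr0n.
have Lam12 : 12 <= Lam0 + 12 by rewrite lerDr ltW.
(* A form in [n] entries multiplies the error by [n]; the successor covers [n = 0]. *)
have etan : 0 < eta / n.+1%:R by rewrite divr_gt0.
have LamP : 0 < Lam0 + 12 by rewrite addr_gt0.
have [T [q [z [zX zsin zdecr]]]] := unimodal_stable_approx p1 p2 LamP etan s0.
have etan1 : eta / n.+1%:R <= eta.
  by rewrite ler_pdivrMr//; apply: ler_peMr; [exact: ltW | rewrite ler1n].
have etan2 : n%:R * (eta / n.+1%:R) <= eta.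
  by rewrite mulrCA ler_piMr ?(ltW eta_gt0)// ler_pdivrMr// mul1r ler_nat.
have {}zX' : stable_approx q z p (Lam0 + 12) eta by move=> l /zX /le_trans; apply.
have [i [i2 ir i40 Glow Ghigh]] := median_gap p1 Lam12 eb zX' s0 s1 r128 zdecr.
have it0 : 0 < i%:R * s by rewrite (lt_le_trans _ i40)// invr_gt0.
have irR : i%:R <= r%:R :> R by rewrite ler_nat.
have i3R : 3 <= i%:R :> R by rewrite ler_nat.
have i2E : (i - 2)%N%:R = i%:R - 2 :> R by rewrite natrB// ltnW.
rewrite gE i2E in Glow; rewrite gE -[i.+1%:R]natr1 in Ghigh.
exists {ffun 'I_n -> T}, (iid q n),
  (fun (t : {ffun 'I_n -> T}) i0 => z (t i0) / (i%:R * s)) => y y1.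
have SE (t : {ffun 'I_n -> T}) : `|\sum_i0 z (t i0) / (i%:R * s) * y i0| =
    `|linear_form z y t| / (i%:R * s).
  have -> : \sum_i0 z (t i0) / (i%:R * s) * y i0 = linear_form z y t / (i%:R * s).
    by rewrite mulr_suml; apply: eq_bigr => j _; rewrite mulrAC [z _ * _]mulrC.
  by rewrite normrM normfV (gtr0_norm it0).
have yX : stable_approx (iid q n) (linear_form z y) p (Lam0 + 12) eta.
  by move=> l /(stable_sum p1 zX zsin y1) /le_trans; apply.
have LamB b : 8 <= b -> 8 / b <= Lam0 + 12.
  move=> b8; have b0 : 0 < b by exact: lt_le_trans b8.
  by rewrite ler_pdivrMr//; clear -b8 Lam00; nra.
have close : charf_close Lam0 eta0 q z (iid q n) (linear_form z y).
  move=> l /andP[l0 lL]; have l0L : 0 <= l <= Lam0 + 12 by rewrite l0 ler_wpDr.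
  have := zX' l l0L; have := yX l l0L; rewrite !ler_norml.
  by move=> /andP[h1 h2] /andP[h3 h4]; clear -h1 h2 h3 h4 ea; apply/andP; split; lra.
have close' : charf_close Lam0 eta0 (iid q n) (linear_form z y) q z.
  by move=> l /close; rewrite distrC.
have tX : prob q (fun a => L < `|z a|) <= g / 32.
  by apply: le_trans (stable_tail p1 L8 (LamB _ L8) zX') _; rewrite LE; clear -ec g0; lra.
have tY : prob (iid q n) (fun a => L < `|linear_form z y a|) <= g / 32.
  by apply: le_trans (stable_tail p1 L8 (LamB _ L8) yX) _; rewrite LE; clear -ec g0; lra.
have eps3 : 3 * s <= eps * (i%:R * s) by clear -i40 sE eps0; rewrite [s in leLHS]sE; nra.
split.
- apply: (@le_trans _ _ (prob (iid q n) (fun t => `|linear_form z y t| <= (i%:R - 3) * s))).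
    by apply: prob_sub => t; rewrite SE ler_pdivrMr// => h; clear -h eps3; lra.
  have := cmp _ _ _ _ _ _ ((i%:R - 3) * s) close'.
  have -> : (i%:R - 3) * s + s = (i%:R - 2) * s by ring.
  have h1 : 0 <= (i%:R - 3) * s by rewrite mulr_ge0 ?subr_ge0// ltW.
  have h2 : (i%:R - 2) * s <= L by apply: le_trans Lr; rewrite ler_pM2r//; clear -irR; lra.
  move=> /(_ h1 h2) h; clear -h Glow tX gap g0; lra.
- apply: (@le_trans _ _ (prob (iid q n) (fun t => ~~ (`|linear_form z y t| <= (i%:R + 2) * s)))).
    by apply: prob_sub => t; rewrite SE ltr_pdivlMr// -ltNge => h; clear -h eps3 s0; lra.
  rewrite probC.
  have := cmp _ _ _ _ _ _ ((i%:R + 1) * s) close.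
  have -> : (i%:R + 1) * s + s = (i%:R + 2) * s by ring.
  have h1 : 0 <= (i%:R + 1) * s by rewrite mulr_ge0 ?addr_ge0// ltW.
  have h2 : (i%:R + 2) * s <= L by apply: le_trans Lr; rewrite ler_pM2r//; clear -irR; lra.
  move=> /(_ h1 h2) h; clear -h Ghigh tY gap g0; lra.
- apply: (@le_trans _ _ (prob (iid q n) (fun t => B / 40 < `|linear_form z y t|))).
    by apply: prob_sub => t; rewrite SE ltr_pdivlMr//; apply: le_lt_trans; rewrite ler_pM2l.
  have B8 : 8 <= B / 40 by clear -B320; lra.
  apply: le_trans (stable_tail p1 B8 (LamB _ B8) yX) _.
  have -> : 8 / (B / 40) = 320 * B^-1 by field; rewrite gt_eqF.
  have B1 : 0 < B^-1 by rewrite invr_gt0.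
  have KB : 645 * B^-1 <= K * B^-1 by rewrite ler_pM2r.
  by clear -ed KB B1; lra.
Qed.

(** * Lp norms and medians *)

Section LpNorm.
Variables (R : realType) (n : nat) (p : R).
Hypothesis p_ge1 : 1 <= p.
Implicit Types (u v : 'cV[R]_n) (a : R).

Let p_gt0 : 0 < p. Proof. exact: lt_le_trans p_ge1. Qed.

Lemma lpnorm_ge0 u : 0 <= lpnorm p u.
Proof. exact: powR_ge0. Qed.

Let sum_ge0 u : 0 <= \sum_i `|u i 0| `^ p.
Proof. by apply: sumr_ge0 => i _; exact: powR_ge0. Qed.

Lemma lpnorm_powR u : lpnorm p u `^ p = \sum_i `|u i 0| `^ p.
Proof. by rewrite -powRrM mulVf ?gt_eqF// powRr1. Qed.

Lemma lpnorm_le u a : 0 <= a -> \sum_i `|u i 0| `^ p <= a `^ p -> lpnorm p u <= a.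
Proof.
move=> a0; rewrite -lpnorm_powR => h; rewrite leNgt; apply/negP => au.
by move: h; apply/negP; rewrite -ltNge gt0_ltr_powR// nnegrE ?lpnorm_ge0.
Qed.

Lemma lpnormZ a u : lpnorm p (a *: u) = `|a| * lpnorm p u.
Proof.
rewrite /lpnorm; have -> : \sum_i `|(a *: u) i 0| `^ p = `|a| `^ p * \sum_i `|u i 0| `^ p.
  by rewrite mulr_sumr; apply: eq_bigr => i _; rewrite mxE normrM powRM.
by rewrite powRM ?powR_ge0// -powRrM mulfV ?gt_eqF// powRr1.
Qed.

Lemma lpnorm0 : lpnorm p (0 : 'cV[R]_n) = 0.
Proof. by rewrite -(scale0r 0) lpnormZ normr0 mul0r. Qed.

Lemma coord_le_lpnorm u i : `|u i 0| <= lpnorm p u.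
Proof.
rewrite leNgt; apply/negP => h.
have : lpnorm p u `^ p < `|u i 0| `^ p by rewrite gt0_ltr_powR// nnegrE lpnorm_ge0.
apply/negP; rewrite -leNgt lpnorm_powR (bigD1 i)//= lerDl sumr_ge0//.
Qed.

Lemma lpnorm_eq0 u : lpnorm p u = 0 -> u = 0.
Proof.
move=> u0; apply/colP => i; rewrite mxE; apply/normr0_eq0/le_anti.
by rewrite normr_ge0 andbT -u0 coord_le_lpnorm.
Qed.

(** Minkowski's inequality from the convexity of [t^p], applied to the coordinates of the normalised
    vectors with weights proportional to the two norms. *)
Lemma lpnormD u v : lpnorm p (u + v) <= lpnorm p u + lpnorm p v.
Proof.
have [/lpnorm_eq0 ->|u_neq0] := eqVneq (lpnorm p u) 0; first by rewrite add0r lpnorm0 add0r.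
have [/lpnorm_eq0 ->|v_neq0] := eqVneq (lpnorm p v) 0; first by rewrite addr0 lpnorm0 addr0.
have u0 : 0 < lpnorm p u by rewrite lt0r u_neq0 lpnorm_ge0.
have v0 : 0 < lpnorm p v by rewrite lt0r v_neq0 lpnorm_ge0.
have uv0 := addr_gt0 u0 v0.
apply: lpnorm_le (ltW uv0) _.
have := lpnorm_powR u; have := lpnorm_powR v.
move: (lpnorm p u) (lpnorm p v) u0 v0 uv0 => a b a0 b0 ab0 bE aE.
have w0 : 0 <= a / (a + b) by rewrite divr_ge0// ltW.
have w1 : a / (a + b) <= 1 by rewrite ler_pdivrMr// mul1r lerDl ltW.
have wE : 1 - a / (a + b) = b / (a + b) by field; rewrite gt_eqF.
have conv i : `|(u + v) i 0| `^ p <= (a + b) `^ p *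
    (a / (a + b) * (`|u i 0| / a) `^ p + b / (a + b) * (`|v i 0| / b) `^ p).
  have := @convex_powR R p p_ge1 (Itv01 w0 w1) (`|u i 0| / a) (`|v i 0| / b).
  rewrite !inE/= !in_itv/= !divr_ge0 ?(ltW a0) ?(ltW b0)// => /(_ isT isT) h.
  have {}h : (a / (a + b) * (`|u i 0| / a) + (1 - a / (a + b)) * (`|v i 0| / b)) `^ p <=
    a / (a + b) * (`|u i 0| / a) `^ p + (1 - a / (a + b)) * (`|v i 0| / b) `^ p by exact: h.
  rewrite wE in h.
  apply: le_trans (ler_wpM2l (powR_ge0 _ _) h).
  have e : a / (a + b) * (`|u i 0| / a) + b / (a + b) * (`|v i 0| / b) =
      (`|u i 0| + `|v i 0|) / (a + b) by field; rewrite !gt_eqF.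
  have x0 : 0 <= `|u i 0| + `|v i 0| by rewrite addr_ge0.
  have y0 : 0 <= (`|u i 0| + `|v i 0|) / (a + b) by rewrite divr_ge0// ltW.
  rewrite e -(powRM _ (ltW ab0) y0) mulrC divfK ?gt_eqF//.
  by apply: ge0_ler_powR; rewrite ?nnegrE ?(ltW p_gt0)// mxE ler_normD.
apply: (le_trans (ler_sum _ (fun i _ => conv i))).
rewrite -mulr_sumr big_split/= -!mulr_sumr.
have unit (w : 'cV[R]_n) (c : R) : 0 < c -> c `^ p = \sum_i `|w i 0| `^ p ->
    \sum_i (`|w i 0| / c) `^ p = 1.
  move=> c0 cE; under eq_bigr do rewrite powRM ?invr_ge0 ?(ltW c0)//.
  rewrite -mulr_suml -cE -powRM ?invr_ge0 ?(ltW c0)// mulfV ?gt_eqF//.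
  by rewrite powR1.
by rewrite (unit u)// (unit v)// !mulr1 -mulrDl mulfV ?gt_eqF// mulr1 lexx.
Qed.

Lemma lpnormN u : lpnorm p (- u) = lpnorm p u.
Proof. by rewrite -scaleN1r lpnormZ normrN1 mul1r. Qed.

Lemma lpnorm_sum (I : Type) (r : seq I) (F : I -> 'cV[R]_n) :
  lpnorm p (\sum_(i <- r) F i) <= \sum_(i <- r) lpnorm p (F i).
Proof.
elim/big_rec2: _ => [|i x y _ h]; first by rewrite lpnorm0.
by apply: le_trans (lpnormD _ _) _; rewrite lerD2l.
Qed.

End LpNorm.

Section Median.
Variable R : realType.

Lemma sorted_count_lt (s : seq R) (a : R) (j : nat) : (j < size s)%N ->
  sorted <=%R s -> s`_j < a -> (j < count (fun x => (x < a)%R) s)%N.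
Proof.
move=> js ss sja; rewrite -(cat_take_drop j.+1 s) count_cat.
apply: leq_trans (leq_addr _ _).
have -> : count (fun x => x < a) (take j.+1 s) = size (take j.+1 s).
  apply/eqP; rewrite -all_count; apply/(all_nthP 0) => i.
  rewrite size_takel// => ij; rewrite nth_take//; apply: le_lt_trans sja.
  apply: (sorted_leq_nth le_trans) => //; rewrite inE//.
  exact: leq_ltn_trans js.
by rewrite size_takel.
Qed.

Lemma sorted_count_gt (s : seq R) (a : R) (j : nat) : (j < size s)%N ->
  sorted <=%R s -> a < s`_j -> (size s - j <= count (fun x => (a < x)%R) s)%N.
Proof.
move=> js ss sja; rewrite -[X in count _ X](cat_take_drop j s) count_cat.
apply: leq_trans (leq_addl _ _).
have -> : count (fun x => a < x) (drop j s) = size (drop j s).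
  apply/eqP; rewrite -all_count; apply/(all_nthP 0) => i.
  rewrite size_drop => ij; rewrite nth_drop; apply: (lt_le_trans sja).
  by apply: (sorted_leq_nth le_trans) => //; rewrite ?inE ?leq_addr // -ltn_subRL.
by rewrite size_drop.
Qed.

(** A strict minority below [a] leaves both middle positions at or above [a] for either parity, and
    excludes the empty sequence. *)
Lemma median_ge (s : seq R) (a : R) :
  (2 * count (fun x => (x < a)%R) s < size s)%N -> a <= median s.
Proof.
move=> h; rewrite /median; set t := sort _ s.
have st : size t = size s by rewrite size_sort.
have tt : sorted <=%R t by apply: sort_sorted; exact: le_total.
have ct : count (fun x => x < a) t = count (fun x => x < a) s.
  by apply/seq.permP; rewrite perm_sort.
have key j : (count (fun x => (x < a)%R) s <= j < size s)%N -> a <= t`_j.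
  move=> /andP[cj js]; rewrite leNgt; apply/negP => /(sorted_count_lt _ tt).
  by rewrite st ct => /(_ js); lia.
have h1 : a <= t`_((size s).-1./2) by apply: key; lia.
have h2 : a <= t`_((size s)./2) by apply: key; lia.
lra.
Qed.

Lemma median_le (s : seq R) (a : R) :
  (2 * count (fun x => (a < x)%R) s < size s)%N -> median s <= a.
Proof.
move=> h; rewrite /median; set t := sort _ s.
have st : size t = size s by rewrite size_sort.
have tt : sorted <=%R t by apply: sort_sorted; exact: le_total.
have ct : count (fun x => a < x) t = count (fun x => a < x) s.
  by apply/seq.permP; rewrite perm_sort.
have key j : (count (fun x => (a < x)%R) s + j < size s)%N -> t`_j <= a.
  move=> cj; rewrite leNgt; apply/negP => /(sorted_count_gt _ tt).
  have js : (j < size t)%N by rewrite st; lia.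
  by rewrite st ct in js * => /(_ js); lia.
have h1 : t`_((size s).-1./2) <= a by apply: key; lia.
have h2 : t`_((size s)./2) <= a by apply: key; lia.
lra.
Qed.

Lemma count_entries (m : nat) (y : 'cV[R]_m) (P : pred R) :
  count P [seq `|y i 0| | i <- enum 'I_m] = #|[set i | P `|y i 0|]%SET|.
Proof. by rewrite -sum1_count big_map big_enum_cond -sum1dep_card. Qed.

Lemma mednorm_ge m (y : 'cV[R]_m) (a : R) :
  (2 * #|[set i | (`|y i 0| < a)%R]%SET| < m)%N -> a <= mednorm y.
Proof.
move=> h; apply: median_ge; rewrite size_map size_enum_ord.
by rewrite (count_entries y (fun x => x < a)).
Qed.

Lemma mednorm_le m (y : 'cV[R]_m) (a : R) :
  (2 * #|[set i | (a < `|y i 0|)%R]%SET| < m)%N -> mednorm y <= a.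
Proof.
move=> h; apply: median_le; rewrite size_map size_enum_ord.
by rewrite (count_entries y (fun x => a < x)).
Qed.

End Median.

(** * Almost Auerbach bases *)

Section NearAuerbach.
Variables (R : realType) (n : nat) (nrm : 'rV[R]_n -> R).
Hypotheses (nrm_coord : forall (v : 'rV[R]_n) i, `|v 0 i| <= nrm v)
  (nrm_ge0 : forall v, 0 <= nrm v)
  (nrmZ : forall a v, nrm (a *: v) = `|a| * nrm v).

Lemma det_bounded (r : nat) (beta : R) (Z : 'M[R]_r) : (forall i j, `|Z i j| <= beta) ->
  `|\det Z| <= \sum_(s : {perm 'I_r}) beta ^+ r.
Proof.
move=> Zb; apply: le_trans (ler_norm_sum _ _ _) _; apply: ler_sum => s _.
rewrite normrM normrX normrN1 expr1n mul1r normr_prod.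
rewrite -[in leRHS](card_ord r) -prodr_const; apply: ler_prod => i _.
by rewrite normr_ge0 Zb.
Qed.

(* Replacing one row of a square matrix of almost maximal determinant does
   not double the determinant, and Cramer's rule turns the ratio of the two
   determinants into a coordinate. *)
Lemma near_auerbach_free (r : nat) (M : 'M[R]_(r, n)) : row_free M ->
  exists Z : 'M[R]_r, [/\ Z \in unitmx, forall i, nrm (row i Z *m M) <= 1 &
    forall (c : 'rV[R]_r) i, `|c 0 i| <= 2 * nrm (c *m Z *m M)].
Proof.
move=> /row_freeP[L ML].
pose admissible (Z : 'M[R]_r) := forall i, nrm (row i Z *m M) <= 1.
pose E : set R := [set x | exists2 Z, admissible Z & x = `|\det Z|].
(* The right inverse [L] recovers [Z] from its image, whose coordinates are bounded by 1; this
   bounds the entries of an admissible [Z], hence its determinant. *)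
pose beta := \sum_k \sum_j `|L k j|.
have E_ub x : E x -> x <= \sum_(s : {perm 'I_r}) beta ^+ r.
  move=> [Z Zadm ->]; apply: det_bounded => i j.
  have -> : Z i j = (row i Z *m M *m L) 0 j by rewrite -mulmxA ML mulmx1 mxE.
  rewrite mxE; apply: le_trans (ler_norm_sum _ _ _) _.
  apply: ler_sum => k _; rewrite normrM (bigD1 j)//= ler_wpDr ?sumr_ge0//.
  by rewrite ler_piMl// (le_trans (nrm_coord _ _)).
have [x Ex x0] : exists2 x, E x & 0 < x.
  pose k := (1 + \sum_i nrm (row i M))^-1.
  have k0 : 0 < k by rewrite invr_gt0 ltr_pwDl// sumr_ge0.
  exists (`|\det (k%:M : 'M[R]_r) |); last by rewrite det_scalar normr_gt0 expf_neq0 ?gt_eqF.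
  exists k%:M => // i; rewrite -row_mul mul_scalar_mx linearZ nrmZ gtr0_norm//.
  rewrite mulrC ler_pdivrMr ?mul1r; last by rewrite -invr_gt0.
  by rewrite (bigD1 i)//= addrCA lerDl addr_ge0// sumr_ge0.
have Esup : has_sup E by split; [exists x | exists (\sum_(s : {perm 'I_r}) beta ^+ r)].
have sup0 : 0 < sup E by apply: lt_le_trans x0 _; apply: sup_ubound => //; case: Esup.
(* Reaching half of the supremum replaces a compactness argument for a maximiser, and is the origin
   of the factor 2. *)
have [y [Z Zadm yE] Zsup] : exists2 y, E y & sup E - sup E / 2 < y.
  have h2 : 0 < sup E / 2 by lra.
  by have [y Ey hy] := sup_adherent h2 Esup; exists y.
have {}Zsup : sup E < 2 * `|\det Z| by rewrite -yE; lra.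
have detZ0 : 0 < `|\det Z| by lra.
exists Z; split=> // [|c i]; first by rewrite unitmxE unitfE -normr_gt0.
set v := c *m Z; set t := nrm (v *m M).
have [t0|t_neq0] := eqVneq t 0.
  have vM0 : v *m M = 0.
    apply/rowP => j; rewrite [RHS]mxE; apply/normr0_eq0/le_anti.
    by rewrite normr_ge0 andbT -t0 nrm_coord.
  have v0 : v = 0 by rewrite -[v]mulmx1 -ML mulmxA vM0 mul0mx.
  have -> : c = 0.
    by rewrite -[c](@mulmxK _ _ _ Z) ?unitmxE ?unitfE -?normr_gt0// -/v v0 mul0mx.
  by rewrite mxE normr0 mulr_ge0// nrm_ge0.
have t0 : 0 < t by rewrite lt0r t_neq0 nrm_ge0.
pose Z' : 'M[R]_r := \matrix_(k, j) if k == i then (t^-1 *: v) 0 j else Z k j.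
have rowZ' k : row k Z' = if k == i then t^-1 *: v else row k Z.
  by apply/rowP => j; rewrite !mxE; case: eqP; rewrite !mxE.
have Z'adm : admissible Z'.
  move=> k; rewrite rowZ'; case: eqP => // _.
  by rewrite -scalemxAl nrmZ gtr0_norm ?invr_gt0// mulVf.
have detZ' : \det Z' = t^-1 * (c 0 i * \det Z).
  rewrite (expand_det_row _ i).
  have -> : \sum_j Z' i j * cofactor Z' i j = ((t^-1 *: v) *m \adj Z) 0 i.
    rewrite [RHS]mxE; apply: eq_bigr => j _.
    rewrite [Z' i j]mxE eqxx [\adj Z j i]mxE; congr (_ * _).
    rewrite /cofactor; congr (_ * \det _); apply/matrixP => a b; rewrite !mxE.
    by rewrite eq_sym (negPf (neq_lift _ _)).
  by rewrite -scalemxAl -mulmxA mul_mx_adj mxE mul_mx_scalar mxE [\det Z * _]mulrC.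
have : `|\det Z'| <= sup E.
  by apply: sup_ubound; [case: Esup|exists Z'].
rewrite detZ' !normrM gtr0_norm ?invr_gt0// => h.
have {h} : t^-1 * (`|c 0 i| * `|\det Z|) <= 2 * `|\det Z| by rewrite (le_trans h)// ltW.
by rewrite mulrA ler_pM2r// mulrC ler_pdivrMr.
Qed.

End NearAuerbach.

(** The columns of [B] may be dependent, so the basis is built on its column space and padded with
    zero vectors up to [D]: the size of the net then does not vary with the rank. *)
Lemma near_auerbach (R : realType) (n D : nat) (p : R) (B : 'M[R]_(n, D)) : 1 <= p ->
  exists e : 'I_D -> 'cV[R]_n, (forall j, lpnorm p (e j) <= 1) /\
    forall z : 'cV[R]_D, exists c : 'I_D -> R,
      (forall j, `|c j| <= 2 * lpnorm p (B *m z)) /\ B *m z = \sum_j c j *: e j.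
Proof.
move=> p1; pose nrm (v : 'rV[R]_n) := lpnorm p v^T.
have nrm_coord (v : 'rV[R]_n) i : `|v 0 i| <= nrm v.
  by have := coord_le_lpnorm p1 v^T i; rewrite mxE.
have nrmZ a v : nrm (a *: v) = `|a| * nrm v by rewrite /nrm linearZ lpnormZ.
have [Z [Zu Z1 Zc]] :=
  near_auerbach_free nrm_coord (fun v => lpnorm_ge0 _ _) nrmZ (row_base_free B^T).
set r := \rank B^T in Z Zu Z1 Zc; have rD : (r <= D)%N := rank_leq_row _.
pose pad (V : nmodType) (F : 'I_r -> V) (k : nat) : V :=
  if insub k is Some i then F i else 0.
have padE (V : nmodType) (F : 'I_r -> V) (i : 'I_r) : pad V F i = F i by rewrite /pad valK.
pose e0 i := (row i Z *m row_base B^T)^T.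
exists (fun j => pad _ e0 j); split=> [j|z].
  by rewrite /pad; case: insub => [i|]; [exact: Z1|rewrite lpnorm0].
have /submxP[c0 zE] : ((B *m z)^T <= row_base B^T)%MS by rewrite eq_row_base trmx_mul submxMl.
pose c := c0 *m invmx Z.
have cE : (B *m z)^T = c *m Z *m row_base B^T by rewrite mulmxKV.
exists (fun j => pad _ (fun i => c 0 i) j); split=> [j|].
  rewrite /pad; case: insub => [i|]; last by rewrite normr0 mulr_ge0// lpnorm_ge0.
  by have := Zc c i; rewrite -cE /nrm trmxK.
have -> : \sum_(j < D) pad _ (fun i => c 0 i) j *: pad _ e0 j =
   \sum_(0 <= j < D) pad _ (fun i => c 0 i) j *: pad _ e0 j by rewrite big_mkord.
rewrite (big_cat_nat _ (n := r))//= [X in _ + X](_ : _ = 0); last first.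
  rewrite big_nat big1// => k /andP[rk _].
  by rewrite {1}/pad insubF ?scale0r// ltnNge rk.
rewrite addr0 big_mkord -[LHS]trmxK cE.
have -> : c *m Z *m row_base B^T = \sum_i c 0 i *: (row i Z *m row_base B^T).
  rewrite (_ : c *m Z = \sum_i c 0 i *: row i Z) ?mulmx_suml.
    by apply: eq_bigr => i _; rewrite scalemxAl.
  exact: mulmx_sum_row.
by rewrite linear_sum /=; apply: eq_bigr => i _; rewrite !padE linearZ.
Qed.

(** * The sketching matrix *)

Section Sketch.
Variable R : realType.

Definition dot (n : nat) (s : 'I_n -> R) (y : 'cV[R]_n) : R := \sum_i s i * y i 0.

Lemma dotB n (s : 'I_n -> R) (u v : 'cV[R]_n) : dot s (u - v) = dot s u - dot s v.
Proof.
by rewrite /dot -sumrB; apply: eq_bigr => i _; rewrite !mxE mulrBr.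
Qed.

Lemma dotZ n (s : 'I_n -> R) a (u : 'cV[R]_n) : dot s (a *: u) = a * dot s u.
Proof. by rewrite /dot mulr_sumr; apply: eq_bigr => i _; rewrite mxE mulrCA. Qed.

Lemma dot_sum n (s : 'I_n -> R) (I : finType) (F : I -> 'cV[R]_n) :
  dot s (\sum_j F j) = \sum_j dot s (F j).
Proof.
rewrite /dot exchange_big; apply: eq_bigr => i _.
by rewrite summxE mulr_sumr.
Qed.

(** The first clause fails at [y = 0], hence the guard on the norm; the tail clause must accept the
    zero vectors that pad a basis. *)
Definition median_functional (K : R) (n : nat) (p eps B : R) :=
  exists (T : finType) (q : law R T) (S : T -> 'I_n -> R), forall y : 'cV[R]_n,
  [/\ lpnorm p y != 0 ->
        prob q (fun t => `|dot (S t) y| <= (1 - eps) * lpnorm p y) <= 1 / 2 - eps / K,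
      lpnorm p y != 0 ->
        prob q (fun t => (1 + eps) * lpnorm p y < `|dot (S t) y|) <= 1 / 2 - eps / K &
      lpnorm p y <= 1 -> prob q (fun t => B < `|dot (S t) y|) <= K / B].

Lemma stable_dot : exists2 K : R, 2 <= K & forall n p eps B,
  1 <= p -> p < 2 -> 0 < eps -> eps < 1 -> K <= B -> median_functional K n p eps B.
Proof.
have [K K2 HK] := stable_functional R.
exists K => // n p eps B p1 p2 eps0 eps1 BK.
have K0 : 0 < K by exact: lt_le_trans K2.
have B0 : 0 < B by exact: lt_le_trans BK.
have [T [q [S H]]] := HK p eps B n p1 p2 eps0 eps1 BK.
exists T, q, S => y; set nu := lpnorm p y.
have [nu0|nu_neq0] := eqVneq nu 0.
  split=> // _; apply: (@le_trans _ _ 0); last by rewrite divr_ge0// ltW.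
  rewrite -[leRHS](expect_cst q); apply: expect_le => t.
  have -> : y = 0 by exact: lpnorm_eq0 nu0.
  rewrite /dot big1 => [|i _]; last by rewrite mxE mulr0.
  by rewrite normr0 ltNge (ltW B0).
have nu0 : 0 < nu by rewrite lt0r nu_neq0 lpnorm_ge0.
have [] := H (fun i => (nu^-1 *: y) i 0).
  by rewrite -lpnorm_powR// lpnormZ// gtr0_norm ?invr_gt0// mulVf// powR1.
have dE t : `|\sum_i S t i * (nu^-1 *: y) i 0| = `|dot (S t) y| / nu.
  by rewrite -/(dot (S t) (nu^-1 *: y)) dotZ normrM gtr0_norm ?invr_gt0// mulrC.
move=> h1 h2 h3; split=> [_|_|nu1].
- apply: le_trans h1; apply: prob_sub => t h.
  by rewrite dE ler_pdivrMr.
- apply: le_trans h2; apply: prob_sub => t h.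
  by rewrite dE ltr_pdivlMr.
- apply: le_trans h3; apply: prob_sub => t h.
  by rewrite dE ltr_pdivlMr// (le_lt_trans _ h)// ler_piMr// ltW.
Qed.

Lemma grid_round (G : nat) (x : R) : (0 < G)%N -> `|x| <= 2 ->
  exists a : 'I_(2 * G).+1, `|x - (a%:R - G%:R) * (2 / G%:R)| <= 2 / G%:R.
Proof.
move=> G0; rewrite ler_norml => /andP[x1 x2].
have G0R : 0 < G%:R :> R by rewrite ltr0n.
set X := (x + 2) * (G%:R / 2).
have X0 : 0 <= X by rewrite mulr_ge0// ?divr_ge0//; lra.
have XG : X <= (2 * G)%N%:R by rewrite natrM /X; nra.
have h1 := X0; rewrite -truncn_le in h1.
have aG : (Num.truncn X < (2 * G).+1)%N by rewrite ltnS -(ler_nat R) (le_trans h1).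
exists (Ordinal aG) => /=.
have h2 := truncnS_gt X; rewrite -natr1 in h2.
have -> : x - ((Num.truncn X)%:R - G%:R) * (2 / G%:R) = (X - (Num.truncn X)%:R) * (2 / G%:R).
  by rewrite /X; field; rewrite gt_eqF.
by rewrite normrM !ger0_norm ?divr_ge0 ?subr_ge0// ler_piMl ?divr_ge0//; lra.
Qed.

(** A support of fewer than [k] indices is filled up with an arbitrary column and coefficient 0, and
    [b] gets coefficient -1. Counting [d^k] maps instead of supports is harmless, because [ln (d /
    k) + ln (k / (eps delta)) = ln (d / (eps delta))]. *)
Lemma sparse_combination (n d k : nat) (A : 'M[R]_(n, d)) (b : 'cV[R]_n) (x : 'cV[R]_d) :
  (0 < d)%N -> sparse k x ->
  exists (f : {ffun 'I_k -> 'I_d}) (z : 'cV[R]_k.+1),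
    A *m x - b = (\matrix_(i, j) if unlift ord0 j is Some j' then A i (f j') else b i 0) *m z.
Proof.
move=> d0 xk; pose i0 : 'I_d := Ordinal d0.
pose supp := [set i : 'I_d | x i 0 != 0]%SET; pose s := enum supp.
have sk : (size s <= k)%N by rewrite -cardE.
exists [ffun j : 'I_k => nth i0 s j].
exists (\col_j if unlift ord0 j is Some j'
  then (if (j' < size s)%N then x (nth i0 s j') 0 else 0) else -1).
apply/colP => i; rewrite !mxE big_ord_recl !mxE unlift_none mulrN1 addrC; congr (_ + _).
transitivity (\sum_(j <- s) A i j * x j 0).
  rewrite big_enum [RHS]big_mkcond; apply: eq_bigr => j _.
  by rewrite inE; case: eqP => //= ->; rewrite mulr0.
rewrite (big_nth i0) big_mkord (big_ord_widen k (fun j => A i (nth i0 s j) * x (nth i0 s j) 0) sk).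
rewrite [LHS]big_mkcond; apply: eq_bigr => j _; rewrite !mxE liftK ffunE.
by case: ifP => // _; rewrite mulr0.
Qed.

Section MeshArithmetic.
Variables (mesh B eps a a' N : R).
Hypotheses (mesh_gt0 : 0 < mesh) (B_gt0 : 0 < B) (eps_gt0 : 0 < eps) (eps_lt1 : eps < 1)
  (mesh_le : mesh * (B + 2) <= eps / 2).

Lemma mesh_lt1 : 0 < 1 - mesh.
Proof. by have := mulr_gt0 mesh_gt0 B_gt0; move: mesh_le eps_lt1; lra. Qed.

(** [a] and [a'] stand for the size of a row on the normalised vector and on its net point, and [N]
    for the norm of the latter. In [mesh * (B + 2)] the term [B] pays for the change of the row
    value, the 2 for that of the norm. *)
Lemma net_low : a' <= a + mesh * B -> a < 1 - eps -> 1 - mesh <= N -> a' <= (1 - eps / 2) * N.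
Proof.
move=> h1 h2 h3; have : (1 - eps / 2) * (1 - mesh) <= (1 - eps / 2) * N.
  by rewrite ler_wpM2l//; move: eps_lt1; lra.
have := mulr_gt0 eps_gt0 mesh_gt0; have := mulr_gt0 mesh_gt0 B_gt0.
move: mesh_le h1 h2 mesh_gt0; lra.
Qed.

Lemma net_high : a <= a' + mesh * B -> 1 + eps < a -> N <= 1 + mesh -> (1 + eps / 2) * N < a'.
Proof.
move=> h1 h2 h3; have : (1 + eps / 2) * N <= (1 + eps / 2) * (1 + mesh).
  by rewrite ler_wpM2l//; move: eps_gt0; lra.
have : 0 < (1 - eps) * mesh by rewrite mulr_gt0// subr_gt0.
move: mesh_le h1 h2 mesh_gt0; lra.
Qed.

End MeshArithmetic.

(** * Union bound over the nets of all supports *)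

Section Deterministic.
Variables (n d k : nat) (A : 'M[R]_(n, d)) (b : 'cV[R]_n) (K p eps : R).
Hypotheses (p_ge1 : 1 <= p) (d_gt0 : (0 < d)%N)
  (eps_gt0 : 0 < eps) (eps_lt1 : eps < 1) (K_ge : 2 <= K).

(* [row_slack] is a third of the gap around 1/2 granted to a single row, and
   [row_cutoff] makes a row exceed it on some of the [k + 1] basis vectors with
   probability at most [row_slack]. *)
Definition row_slack : R := eps / (6 * K).
Definition row_cutoff : R := K * k.+1%:R / row_slack.
Definition net_mesh : nat := (Num.truncn (4 * k.+1%:R * (row_cutoff + 2) / eps)).+1.
(** The number of events in the union bound: for every choice of columns, one event for a row large
    on the basis, and two, low and high, for every grid point. *)
Definition net_size : nat := d ^ k * (2 * (2 * net_mesh).+1 ^ k.+1).+1.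

Let tau := row_slack.
Let B := row_cutoff.
Let G := net_mesh.

Hypothesis functional : median_functional K n p (eps / 2) B.

Let K_gt0 : 0 < K. Proof. exact: lt_le_trans K_ge. Qed.

Let tau_gt0 : 0 < tau. Proof. by rewrite divr_gt0// mulr_gt0. Qed.

Let tau_le : 3 * tau <= 1 / 2.
Proof.
have : eps / (6 * K) <= 1 / 6 by rewrite ler_pdivrMr ?mulr_gt0//; move: eps_lt1 K_ge; lra.
by rewrite -/row_slack -/tau; lra.
Qed.

Let B_gt0 : 0 < B. Proof. by rewrite divr_gt0// mulr_gt0. Qed.

Let mesh : R := k.+1%:R * (2 / G%:R).

Let mesh_gt0 : 0 < mesh. Proof. by rewrite mulr_gt0// divr_gt0. Qed.

Let mesh_le : mesh * (B + 2) <= eps / 2.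
Proof.
have : 4 * k.+1%:R * (B + 2) / eps <= G%:R by rewrite ltW// /G /net_mesh truncnS_gt.
rewrite ler_pdivrMr// => h.
have -> : mesh * (B + 2) = 4 * k.+1%:R * (B + 2) / G%:R / 2.
  by rewrite /mesh; field; rewrite pnatr_eq0.
by rewrite ler_pM2r// ler_pdivrMr ?ltr0n// [eps * _]mulrC.
Qed.

Lemma med_embedding_exists (m : nat) : (0 < m)%N ->
  net_size%:R * expR (- (m%:R * (tau ^+ 2 / 8))) < 1 ->
  exists S : 'M[R]_(m, n), med_embedding k p eps A b S.
Proof.
move=> m0 msize.
have [T [q [S HS]]] := functional.
pose M (f : {ffun 'I_k -> 'I_d}) : 'M[R]_(n, k.+1) :=
  \matrix_(i, j) if unlift ord0 j is Some j' then A i (f j') else b i 0.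
have /fin_all_exists[e He] (f : {ffun 'I_k -> 'I_d}) := near_auerbach (M f) p_ge1.
pose grid (a : 'I_(2 * G).+1) : R := (a%:R - G%:R) * (2 / G%:R).
pose net (f : {ffun 'I_k -> 'I_d}) (h : {ffun 'I_k.+1 -> 'I_(2 * G).+1}) :=
  \sum_j grid (h j) *: e f j.
pose large f (t : T) := [exists j, B < `|dot (S t) (e f j)|].
(* A grid combination may vanish; the guard makes its event empty. The net points used below have
   norm at least [1 - mesh > 0]. *)
pose low f h (t : T) := (lpnorm p (net f h) != 0) &&
  (`|dot (S t) (net f h)| <= (1 - eps / 2) * lpnorm p (net f h)).
pose high f h (t : T) := (lpnorm p (net f h) != 0) &&
  ((1 + eps / 2) * lpnorm p (net f h) < `|dot (S t) (net f h)|).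
pose I : finType := ({ffun 'I_k -> 'I_d} * option ({ffun 'I_k.+1 -> 'I_(2 * G).+1} * bool))%type.
pose bad (g : I) (t : T) := match g with
  | (f, None) => large f t
  | (f, Some (h, true)) => low f h t
  | (f, Some (h, false)) => high f h t
  end.
pose rho (g : I) : R := if g.2 is None then tau else 1 / 2 - 3 * tau.
have tau3 : 3 * tau = eps / 2 / K by rewrite /tau /row_slack; field; rewrite gt_eqF.
have half0 : 0 <= 1 / 2 - 3 * tau by rewrite subr_ge0.
have bad_le g : prob q (bad g) <= rho g.
  case: g => f [[h []]|]; rewrite /rho /=.
  - have [h1 _ _] := HS (net f h); rewrite tau3.
    rewrite /bad /low; have [z|z] := eqVneq (lpnorm p (net f h)) 0.
      by rewrite -tau3 /= /prob expect_cst.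
    exact: h1.
  - have [_ h1 _] := HS (net f h); rewrite tau3.
    rewrite /bad /high; have [z|z] := eqVneq (lpnorm p (net f h)) 0.
      by rewrite -tau3 /= /prob expect_cst.
    exact: h1.
  - apply: le_trans (prob_exists q (fun j t => B < `|dot (S t) (e f j)|)) _.
    apply: (@le_trans _ _ (\sum_(j < k.+1) K / B)).
      by apply: ler_sum => j _; have [_ _] := HS (e f j); apply; case: (He f).
    rewrite sumr_const card_ord -mulr_natl /B /row_cutoff -/tau le_eqVlt.
    apply/orP; left; apply/eqP.
    by field; rewrite !gt_eqF.
have cardI : #|I| = net_size.
  rewrite card_prod card_option card_prod !card_ffun !card_ord card_bool.
  by rewrite [(_ * 2)%N]mulnC.
have [||t Ht] := @iid_sample_exists R T q m I bad rho tau bad_le (ltW tau_gt0).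
- by move: tau_le tau_gt0; lra.
- by rewrite cardI.
pose Sm : 'M[R]_(m, n) := \matrix_(i, j) S (t i) j.
have SmE y i : (Sm *m y) i 0 = dot (S (t i)) y by rewrite mxE; apply: eq_bigr => j _; rewrite mxE.
exists Sm => x xk; have [f [z ->]] := sparse_combination A b d_gt0 xk; rewrite -/(M f).
have [e1 /(_ z)[c [c2 yE]]] := He f; move: (M f *m z) c2 yE => y.
have [nu nuE] : exists nu, nu = lpnorm p y by exists (lpnorm p y).
rewrite -nuE => c2 yE.
have mR : 0 < m%:R :> R by rewrite ltr0n.
(* The budget closes exactly: [2 tau] for the large rows and [1/2 - 2 tau] for the bad values at the
   net point sum to 1/2, and the strict inequalities leave a strict minority. *)
have count2 (P Q1 Q2 : pred 'I_m) : (forall i, P i -> Q1 i || Q2 i) ->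
    #|[set i | Q1 i]%SET|%:R < m%:R * (tau + tau) ->
    #|[set i | Q2 i]%SET|%:R < m%:R * (1 / 2 - 3 * tau + tau) ->
    (2 * #|[set i | P i]%SET| < m)%N.
  move=> PQ h1 h2; rewrite -(ltr_nat R) natrM.
  have : #|[set i | P i]%SET|%:R <= #|[set i | Q1 i]%SET|%:R + #|[set i | Q2 i]%SET|%:R :> R.
    rewrite -natrD ler_nat; apply: leq_trans (leq_card_setU _ _).
    by apply: subset_leq_card; apply/fintype.subsetP => i; rewrite !inE => /PQ.
  by move: h1 h2; lra.
(* The zero vector cannot be normalised, but its image is exactly 0. *)
have [nu0|nu_neq0] := eqVneq nu 0.
  have y0 : y = 0 by apply: (lpnorm_eq0 p_ge1); rewrite -nuE.
  have Sy0 : Sm *m y = 0 by rewrite y0 mulmx0.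
  rewrite nu0 !mulr0 Sy0; split.
    apply: mednorm_ge; rewrite (_ : [set i | _]%SET = finset.set0) ?cards0 ?muln0//.
    by apply/setP => i; rewrite !inE mxE normr0 ltxx.
  apply: mednorm_le; rewrite (_ : [set i | _]%SET = finset.set0) ?cards0 ?muln0//.
  by apply/setP => i; rewrite !inE mxE normr0 ltxx.
have nu0 : 0 < nu by rewrite lt0r nu_neq0 nuE lpnorm_ge0.
have /fin_all_exists[h Hh] (j : 'I_k.+1) :
    exists a : 'I_(2 * G).+1, `|c j / nu - grid a| <= 2 / G%:R.
  apply: grid_round => //.
  by rewrite normrM normfV (gtr0_norm nu0) ler_pdivrMr.
pose H := [ffun j => h j]; have [y' y'E] : exists y', y' = net f H by exists (net f H).
have diffE : nu^-1 *: y - y' = \sum_j (c j / nu - grid (h j)) *: e f j.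
  rewrite yE scaler_sumr y'E /net -sumrB; apply: eq_bigr => j _.
  by rewrite ffunE scalerBl scalerA [nu^-1 * _]mulrC.
have y1 : lpnorm p (nu^-1 *: y) = 1 by rewrite lpnormZ// -nuE gtr0_norm ?invr_gt0// mulVf.
have diff_norm : lpnorm p (nu^-1 *: y - y') <= mesh.
  rewrite diffE; apply: le_trans (lpnorm_sum p_ge1 _ _) _.
  rewrite /mesh -[k.+1 in leRHS]card_ord mulr_natl -sumr_const; apply: ler_sum => j _.
  by rewrite lpnormZ// -[leRHS]mulr1 ler_pM ?lpnorm_ge0.
have tri (u v : 'cV[R]_n) : lpnorm p u <= lpnorm p v + lpnorm p (u - v).
  by have := lpnormD p_ge1 v (u - v); rewrite subrKC.
have y'le : lpnorm p y' <= 1 + mesh.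
  rewrite (le_trans (tri y' (nu^-1 *: y)))//.
  by rewrite y1 lerD2l -opprB lpnormN.
have y'ge : 1 - mesh <= lpnorm p y'.
  by rewrite lerBlDr -y1 (le_trans (tri _ y'))// lerD2l.
have mesh_small := mesh_le; have mesh0 := mesh_gt0; have B0 := B_gt0.
have mesh1 : 0 < 1 - mesh := mesh_lt1 mesh0 B0 eps_lt1 mesh_small.
have y'neq0 : lpnorm p y' != 0 by exact: lt0r_neq0 (lt_le_trans mesh1 y'ge).
have diff_dot s : ~~ large f s -> `|dot (S s) (nu^-1 *: y) - dot (S s) y'| <= mesh * B.
  rewrite negb_exists => /forallP hs.
  rewrite -dotB diffE dot_sum; apply: le_trans (ler_norm_sum _ _ _) _.
  have -> : mesh * B = \sum_(j < k.+1) 2 / G%:R * B.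
    by rewrite sumr_const card_ord -[RHS]mulr_natl mulrA.
  apply: ler_sum => j _.
  by rewrite dotZ normrM ler_pM// leNgt hs.
have scale s : `|dot (S s) (nu^-1 *: y)| = `|dot (S s) y| / nu.
  by rewrite dotZ normrM gtr0_norm ?invr_gt0// mulrC.
have Hlarge := Ht (f, None); rewrite /rho /= in Hlarge.
have Hlow := Ht (f, Some (H, true)); rewrite /rho /= in Hlow.
have Hhigh := Ht (f, Some (H, false)); rewrite /rho /= in Hhigh.
split.
- apply: mednorm_ge; apply: (count2 _ _ _ _ Hlarge Hlow) => i; rewrite SmE => hi.
  have [//|/diff_dot hd] := boolP (large f (t i)); rewrite /= /low -y'E y'neq0 /=.
  apply: (net_low mesh0 B0 eps_gt0 eps_lt1 mesh_small _ _ y'ge).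
    rewrite -lerBlDl; apply: le_trans hd; rewrite distrC; exact: lerB_dist.
  by rewrite scale ltr_pdivrMr.
- apply: mednorm_le; apply: (count2 _ _ _ _ Hlarge Hhigh) => i; rewrite SmE => hi.
  have [//|/diff_dot hd] := boolP (large f (t i)); rewrite /= /high -y'E y'neq0 /=.
  apply: (net_high mesh0 eps_gt0 eps_lt1 mesh_small _ _ y'le).
    rewrite -lerBlDl; apply: le_trans hd; exact: lerB_dist.
  by rewrite scale ltr_pdivlMr.
Qed.

End Deterministic.
End Sketch.

(** [2 Q^(k+1) + 1 <= Q^(k+2) <= Q^(3k)]; a pure [k]-th power gives a logarithm proportional to
    [k]. *)
Lemma net_count_le (d k Q : nat) : (0 < d)%N -> (0 < k)%N -> (3 <= Q)%N ->
  (d ^ k * (2 * Q ^ k.+1).+1 <= (d * Q ^ 3) ^ k)%N.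
Proof.
move=> d0 k0 Q3; rewrite expnMn leq_pmul2l ?expn_gt0 ?d0// -expnM.
apply: (@leq_trans (Q * Q ^ k.+1)); last by rewrite -expnS leq_exp2l; lia.
apply: (@leq_trans (3 * Q ^ k.+1)); last by rewrite leq_mul2r Q3 orbT.
have : (0 < Q ^ k.+1)%N by rewrite expn_gt0 (leq_trans _ Q3).
by lia.
Qed.

(** * Counting rows *)

Section NetSize.
Variable R : realType.

(** With [k + 1 <= 2 k] the leading term is [2 * 24 * 4 = 192] times [K^2 (k / eps)^2]; the rest of
    209 absorbs the lower-order terms, using [K^2 >= 4] and [k / eps >= 1]. *)
Lemma net_mesh_le (K eps : R) (k : nat) : 2 <= K -> (0 < k)%N -> 0 < eps -> eps < 1 ->
  (2 * net_mesh k K eps).+1%:R <= 209 * K ^+ 2 * (k%:R / eps) ^+ 2.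
Proof.
move=> K2 k0 eps0 eps1.
have k1 : 1 <= k%:R :> R by rewrite ler1n.
have W1 : 1 <= k%:R / eps by rewrite ler_pdivlMr// mul1r (le_trans (ltW eps1)).
have K0 : 0 < K by exact: lt_le_trans K2.
have cE : 4 * k.+1%:R * (row_cutoff k K eps + 2) / eps =
    24 * K ^+ 2 * (k.+1%:R / eps) ^+ 2 + 8 * (k.+1%:R / eps).
  by rewrite /row_cutoff /row_slack; field; rewrite !gt_eqF.
have V0 : 0 <= k.+1%:R / eps by rewrite divr_ge0// ltW.
have V2 : k.+1%:R / eps <= 2 * (k%:R / eps).
  by rewrite mulrA ler_pM2r ?invr_gt0// -natr1; clear -k1; lra.
have h0 : 0 <= 4 * k.+1%:R * (row_cutoff k K eps + 2) / eps.
  rewrite cE; apply: addr_ge0; last exact: mulr_ge0.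
  apply: mulr_ge0; last exact: sqr_ge0.
  by apply: mulr_ge0 => //; exact: sqr_ge0.
have := h0; rewrite -truncn_le /net_mesh; set t := Num.truncn _ => ht.
rewrite cE in ht.
have -> : (2 * t.+1).+1%:R = 2 * t%:R + 3 :> R by rewrite -natr1 natrM -natr1; ring.
move: ht V0 V2 W1; set V := k.+1%:R / eps; set W := k%:R / eps; set T := t%:R.
move=> ht V0 V2 W1; clear -ht V0 V2 W1 K2.
have v2 : V ^+ 2 <= 4 * W ^+ 2 by nra.
have w2 : W <= W ^+ 2 by nra.
have k4 : 4 <= K ^+ 2 by nra.
have kv : K ^+ 2 * V ^+ 2 <= K ^+ 2 * (4 * W ^+ 2) by rewrite ler_wpM2l// sqr_ge0.
have kw : 4 * W ^+ 2 <= K ^+ 2 * W ^+ 2 by rewrite ler_wpM2r// sqr_ge0.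
by lra.
Qed.

(** The 7 is one logarithm for [d] and six for [Q^3], as [Q] is quadratic in [k / eps]. *)
Lemma ln_net_size_le (K eps : R) (d k : nat) :
  2 <= K -> (0 < k)%N -> (k <= d)%N -> 0 < eps -> eps < 1 ->
  ln (net_size d k K eps)%:R <= k%:R * (7 * ln (d%:R / eps) + 3 * ln (209 * K ^+ 2)).
Proof.
move=> K2 k0 kd eps0 eps1.
have K0 : 0 < K by exact: lt_le_trans K2.
have d0 : (0 < d)%N by exact: leq_trans kd.
have dR : 1 <= d%:R :> R by rewrite ler1n.
have dR0 : 0 < d%:R :> R by rewrite ltr0n.
have kR0 : 0 < k%:R :> R by rewrite ltr0n.
have kdR : k%:R <= d%:R :> R by rewrite ler_nat.
have := net_mesh_le K2 k0 eps0 eps1; rewrite /net_size.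
set Q := (2 * _).+1 => QK.
have Q3 : (3 <= Q)%N by rewrite /Q /net_mesh; lia.
have Q0 : 0 < Q%:R :> R by rewrite ltr0n.
have size_le := net_count_le d0 k0 Q3.
have dQ : 0 < (d * Q ^ 3)%N%:R :> R.
  by rewrite ltr0n muln_gt0 d0 expn_gt0 (leq_trans _ Q3).
apply: (@le_trans _ _ (ln ((d * Q ^ 3) ^ k)%N%:R)).
  have s0 : (0 < d ^ k * (2 * Q ^ k.+1).+1)%N by rewrite muln_gt0 expn_gt0 d0.
  by rewrite ler_ln ?posrE ?ltr0n ?ler_nat// (leq_trans s0).
rewrite natrX lnXn// -[leLHS]mulr_natl ler_pM2l//.
rewrite natrM natrX lnM ?posrE ?exprn_gt0// lnXn//.
have W0 : 0 < k%:R / eps by rewrite divr_gt0.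
have lnQ : ln Q%:R <= ln (209 * K ^+ 2) + 2 * ln (k%:R / eps).
  have K2p : 0 < 209 * K ^+ 2 by rewrite mulr_gt0// exprn_gt0.
  rewrite [2 * ln _]mulr_natl -lnXn// -lnM ?posrE ?exprn_gt0// ler_ln ?posrE//.
  by rewrite mulr_gt0// exprn_gt0.
have lnk : ln (k%:R / eps) <= ln (d%:R / eps).
  by rewrite ler_ln ?posrE ?divr_gt0// ler_pM2r ?invr_gt0.
have lnd : ln d%:R <= ln (d%:R / eps).
  rewrite ler_ln ?posrE ?divr_gt0// ler_pdivlMr// ler_piMr// ?ltW//.
rewrite -[ln Q%:R *+ 3]mulr_natl; clear -lnQ lnk lnd; lra.
Qed.

Lemma ln2_ge : 2^-1 <= ln 2 :> R.
Proof.
rewrite -[leLHS]expRK ler_ln ?posrE ?expR_gt0//.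
by apply: le_trans (expR_le_quadratic _ _) _; lra.
Qed.

(** The third bound absorbs the constant part of the logarithm of the net size. If [d / eps >= 2],
    the logarithm is at least 1/2; otherwise [d = k = 1] and [eps > 1/2], and the cutoff at 1 in
    [row_bound] takes over. *)
Lemma row_bound_ge (d k : nat) (eps delta : R) :
  (0 < k)%N -> (k <= d)%N -> 0 < eps -> eps < 1 -> 0 < delta -> delta < 1 ->
  [/\ 1 <= row_bound d k eps delta,
      k%:R * ln (d%:R / eps) / eps ^+ 2 <= row_bound d k eps delta &
      k%:R / eps ^+ 2 <= 4 * row_bound d k eps delta].
Proof.
move=> k0 kd eps0 eps1 del0 del1.
have d0 : (0 < d)%N by exact: leq_trans kd.
have dR0 : 0 < d%:R :> R by rewrite ltr0n.
have kR0 : 0 < k%:R :> R by rewrite ltr0n.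
have e20 : 0 < eps ^+ 2 by rewrite exprn_gt0.
have b1 : 1 <= row_bound d k eps delta by rewrite le_max lexx.
have b2 : k%:R * ln (d%:R / eps) / eps ^+ 2 <= row_bound d k eps delta.
  rewrite le_max; apply/orP; right; rewrite ler_pM2r ?invr_gt0// ler_pM2l//.
  have a1 : 0 < d%:R / k%:R :> R by exact: divr_gt0.
  have a2 : 0 < k%:R / (eps * delta) by apply: divr_gt0 => //; exact: mulr_gt0.
  have a3 : 0 < d%:R / eps by exact: divr_gt0.
  have a4 := mulr_gt0 a1 a2.
  rewrite -lnM ?posrE// ler_ln ?posrE//.
  have -> : d%:R / k%:R * (k%:R / (eps * delta)) = d%:R / eps / delta.
    by field; rewrite !gt_eqF.
  by rewrite ler_pdivlMr//; apply: ler_piMr; apply: ltW.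
split => //.
have [de|de] := leP 2 (d%:R / eps).
  have l2 : 2^-1 <= ln (d%:R / eps).
    by apply: le_trans ln2_ge _; rewrite ler_ln ?posrE ?divr_gt0.
  have : k%:R / eps ^+ 2 * 2^-1 <= k%:R / eps ^+ 2 * ln (d%:R / eps).
    by rewrite ler_pM2l// divr_gt0.
  rewrite [_ / _ * ln _]mulrAC; move: b2 b1; clear; lra.
have de2 : d%:R < 2 * eps by move: de; rewrite ltr_pdivrMr.
have d1 : d = 1%N.
  apply/eqP; rewrite eqn_leq d0 andbT -ltnS -(ltr_nat R).
  by clear -de2 eps1; lra.
have k1 : k = 1%N by apply/eqP; rewrite eqn_leq k0 andbT -d1.
rewrite {1}k1 ler_pdivrMr//; rewrite d1 in de2.
have e4 : 4^-1 <= eps ^+ 2 by clear -de2 eps0; nra.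
rewrite -mulrA; move: b1; set rb := row_bound _ _ _ _ => b1.
have : rb * 4^-1 <= rb * eps ^+ 2 by rewrite ler_wpM2l// (le_trans _ b1).
by clear -b1; lra.
Qed.

End NetSize.

Theorem theorem6 (R : realType) :
  exists C : R, 0 < C /\
  forall (n d k : nat) (A : 'M[R]_(n, d)) (b : 'cV[R]_n) (p eps delta : R),
    1 <= p -> p < 2 ->
    (1 <= k)%N -> (k <= d)%N ->
    0 < eps -> eps < 1 ->
    0 < delta -> delta < 1 ->
    exists m : nat,
      (0 < m)%N /\
      m%:R <= C * row_bound d k eps delta /\
      exists (disp : measure_display) (Omega : measurableType disp)
             (P : probability Omega R) (S : Omega -> 'M[R]_(m, n)),
        random_matrix S /\
        measurable [set w | med_embedding k p eps A b (S w)] /\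
        ((1 - delta)%:E <= P [set w | med_embedding k p eps A b (S w)])%E.
Proof.
have [K K2 HK] := stable_dot R.
have K0 : 0 < K by exact: lt_le_trans K2.
have Ksq : 1 <= K ^+ 2 by clear -K2; nra.
pose c := 3 * ln (209 * K ^+ 2).
have c0 : 0 <= c by rewrite mulr_ge0// ln_ge0//; clear -Ksq; lra.
pose M := 8 * (36 * K ^+ 2).
have M0 : 0 < M by rewrite /M; clear -Ksq; lra.
(* [M / eps^2] is [8 / tau^2]; 7 and [c] come from the net size, 4 from the third part of
   [row_bound_ge], and the final 1 from rounding [m] up. *)
exists (M * (7 + 4 * c) + 1); split.
  by rewrite addr_gt0// mulr_gt0// ltr_wpDr// mulr_ge0.
move=> n d k A b p eps delta p1 p2 k0 kd eps0 eps1 del0 del1.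
have d0 : (0 < d)%N by exact: leq_trans kd.
have eps20 : 0 < eps / 2 by rewrite divr_gt0.
have eps21 : eps / 2 < 1 by clear -eps1; lra.
have e20 : 0 < eps ^+ 2 by rewrite exprn_gt0.
have tau0 : 0 < row_slack K eps by rewrite divr_gt0// mulr_gt0.
have cutoff : K <= row_cutoff k K eps.
  rewrite ler_pdivlMr// ler_wpM2l ?(ltW K0)//.
  apply: (@le_trans _ _ 1); last by rewrite ler1n.
  by rewrite ler_pdivrMr ?mulr_gt0//; clear -eps1 K2; lra.
pose N : R := (net_size d k K eps)%:R.
have N1 : 1 <= N by rewrite ler1n muln_gt0 expn_gt0 d0.
have tauE : 8 / row_slack K eps ^+ 2 = M / eps ^+ 2.
  by rewrite /row_slack /M; field; rewrite !gt_eqF.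
pose m := (Num.truncn (8 / row_slack K eps ^+ 2 * ln N)).+1.
have h0 : 0 <= 8 / row_slack K eps ^+ 2 * ln N.
  by rewrite mulr_ge0 ?ln_ge0// divr_ge0// sqr_ge0.
have mN : N * expR (- (m%:R * (row_slack K eps ^+ 2 / 8))) < 1.
  have N0 : 0 < N by exact: lt_le_trans N1.
  rewrite -{1}(lnK (N0 : N \in Num.pos)) -expRD expR_lt1 subr_lt0.
  have := truncnS_gt (8 / row_slack K eps ^+ 2 * ln N); rewrite -/m.
  rewrite mulrAC ltr_pdivrMr ?exprn_gt0// => h.
  rewrite mulrA ltr_pdivlMr//; clear -h; lra.
have [S HS] := med_embedding_exists A b p1 d0 eps0 eps1 K2
   (HK n p _ _ p1 p2 eps20 eps21 cutoff) (isT : (0 < m)%N) mN.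
exists m; split=> //; split.
  have [r1 r2 r3] := row_bound_ge k0 kd eps0 eps1 del0 del1.
  have lnN := ln_net_size_le K2 k0 kd eps0 eps1; rewrite -/N -/c in lnN.
  have := h0; rewrite -truncn_le -(lerD2r 1) natr1 -/m => /le_trans; apply.
  rewrite tauE.
  move: r1 r2 r3 lnN; set l := ln (d%:R / eps); set rb := row_bound _ _ _ _ => r1 r2 r3 lnN.
  have : M / eps ^+ 2 * ln N <= M / eps ^+ 2 * (k%:R * (7 * l + c)).
    by rewrite ler_pM2l// divr_gt0.
  have -> : M / eps ^+ 2 * (k%:R * (7 * l + c)) =
     M * (7 * (k%:R * l / eps ^+ 2) + c * (k%:R / eps ^+ 2)).
    by field; rewrite gt_eqF.
  move=> h; rewrite mulrDl mul1r; apply: lerD r1; apply: (le_trans h).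
  rewrite -[leRHS]mulrA ler_pM2l// [leRHS]mulrDl; apply: lerD; first by rewrite ler_pM2l.
  by rewrite [4 * c]mulrC -[leRHS]mulrA ler_wpM2l.
(* A deterministic matrix, found by the probabilistic method, suffices. *)
exists _, unit, (\d_tt : probability unit R), (fun=> S).
have -> : [set _ : unit | med_embedding k p eps A b S] = setT by apply/seteqP; split.
split; first by move=> i j; exact: measurable_cst.
split; first exact: measurableT.
by rewrite probability_setT lee_fin; clear -del0; lra.
Qed.
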